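(* Let $D$ be a Borel data structure and $X=(X_a)_{a\in\binom{\mathbb{N}}{<\infty}}$ an exchangeable $D$-measurement using IDs $\mathbb{N}$. The following are equivalent: (i) $X$ is ergodic. (ii) $X$ has the independence property: $X_a$ and $X_b$ are stochastically independent for all finite $a,b\subset\mathbb{N}$ with $a\cap b=\emptyset$. (iii) For every countable set $\mathcal{G}\subseteq\bigcup_{k\ge0}\mathbb{R}^{D_{[k]}}$ of bounded measurable functions there exists a deterministic sequence $(x_n)_{n\in\mathbb{N}}$ with $x_n\in D_{[m_n]}$ such that $m_n\to\infty$ and, for every $g\in\mathcal{G}$, $g:D_{[k]}\to\mathbb{R}$, $$\mathbb{E}[g(X_{[k]})]=\lim_{n\to\infty}\mathrm{avg}(g,m_n)(x_n).$$
   Context: $[k]=\{1,\dots,k\}$, $[0]=\emptyset$; $\binom{\mathbb{N}}{<\infty}$ is the set of finite subsets of $\mathbb{N}$; for $b\subseteq a$, $\iota_{b,a}$ is the inclusion. A Borel space is a measurable space admitting a bi-measurable bijection onto a Borel subset of $[0,1]$. A Borel data structure (BDS) $D$ is a rule mapping every finite set $a$ to a Borel space $D_a$ and every injection $\tau:b\to a$ between finite sets to a measurable map $D[\tau]:D_a\to D_b$, with $D[\mathrm{id}_a]=\mathrm{id}_{D_a}$ and $D[\sigma\circ\tau]=D[\tau]\circ D[\sigma]$. An exchangeable $D$-measurement using IDs $\mathbb{N}$ is a collection of random variables $X=(X_a)_{a\in\binom{\mathbb{N}}{<\infty}}$, $X_a$ with values in $D_a$, such that $D[\iota_{a',a}](X_a)=X_{a'}$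 almost surely for all $a'\subseteq a$, and $D[\pi](X_a)$ equals $X_a$ in distribution for every bijection $\pi:a\to a$. Let $D_{\mathbb{N}}=\{(x_a)_a\in\prod_{a\in\binom{\mathbb{N}}{<\infty}}D_a: D[\iota_{a',a}](x_a)=x_{a'}\ \forall a'\subseteq a\}$; $X$ is regarded as a $D_{\mathbb{N}}$-valued random variable. For a bijection $\pi:\mathbb{N}\to\mathbb{N}$ and $x\in D_{\mathbb{N}}$ let $D[\pi](x)=(D[\pi|_b](x_{\pi(b)}))_{b}$, where $\pi|_b:b\to\pi(b)$ is the restricted bijection. Let $\mathcal{I}$ be the $\sigma$-field of measurable $M\subseteq D_{\mathbb{N}}$ with $D[\pi](M)=M$ for all bijections $\pi$ of $\mathbb{N}$ fixing all but finitely many points. $X$ is ergodic if $\mathbb{P}[X\in M]\in\{0,1\}$ for all $M\in\mathcal{I}$. For $g:D_{[k]}\to\mathbb{R}$ and $n\ge k$, $\mathrm{avg}(g,n):D_{[n]}\to\mathbb{R}$ is $\mathrm{avg}(g,n)=\frac{(n-k)!}{n!}\sum_{\tau:[k]\to[n]\text{ injective}}g\circ D[\tau]$. In (iii) each function $g\in\mathcal{G}$ carries its $k$; the average is considered for $n$ large enough that $m_n\ge k$. *)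

(* Defs.v *)
From HB Require Import structures.
From mathcomp Require Import all_boot all_order all_algebra.
From mathcomp Require Import finmap.
From mathcomp Require Import all_classical all_reals all_analysis.

Set Implicit Arguments.
Unset Strict Implicit.
Unset Printing Implicit Defensive.

Import Order.TTheory GRing.Theory Num.Theory.
Import numFieldNormedType.Exports.

Local Open Scope classical_set_scope.
Local Open Scope ring_scope.

(* A Borel subset of [0,1] is a Borel subset of R contained in [0,1].  As
   measurableType's are pointed, only nonempty Borel spaces are covered; this
   loses nothing here, as all values of a functor on which a measurement exists
   are nonempty. *)
Definition Borel_space (R : realType) d (T : measurableType d) : Prop :=
  exists (B : set R) (f : T -> R),
    [/\ measurable B, B `<=` `[0, 1], set_bij setT B f,
        measurable_fun setT f
      & forall A : set T, measurable A -> measurable (f @` A)].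

(* Contravariant functors from finite sets and injections to Borel spaces.
   The value of bds_map does not depend on the injectivity proof, by proof
   irrelevance.  The base points of the spaces are not preserved, and are not
   part of the mathematical structure. *)
Record BDS (R : realType) (d : measure_display) := MkBDS {
  bds_obj :> finType -> measurableType d;
  bds_map : forall (b a : finType) (t : b -> a), injective t ->
    bds_obj a -> bds_obj b;
  bds_Borel : forall a : finType, Borel_space R (bds_obj a);
  bds_measurable : forall (b a : finType) (t : b -> a) (t_inj : injective t),
    measurable_fun setT (bds_map t_inj);
  bds_map_id : forall (a : finType) (x : bds_obj a),
    bds_map (@inj_id a) x = x;
  bds_map_comp : forall (c b a : finType) (s : b -> a) (t : c -> b)
      (s_inj : injective s) (t_inj : injective t) (x : bds_obj a),
    bds_map (inj_comp s_inj t_inj) x = bds_map t_inj (bds_map s_inj x)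
}.
Arguments bds_map {R d} _ {b a t}.

(* The positive integers 1, 2, 3, ... *)
Definition IDs : Type := {n : nat | (0 < n)%N}.

Definition ID_succ (i : nat) : IDs := exist _ i.+1 (ltn0Sn i).

(* [k] = {1, ..., k} *)
Definition initseg (k : nat) : {fset IDs} :=
  [fset ID_succ i | i in iota 0 k]%fset.

Definition distrib_eq d d' (T : measurableType d) (E : measurableType d')
    (R : realType) (P : probability T R) (Y Z : T -> E) : Prop :=
  forall B : set E, measurable B -> P (Y @^-1` B) = P (Z @^-1` B).

Definition independent_RV d d1 d2 (T : measurableType d)
    (E1 : measurableType d1) (E2 : measurableType d2) (R : realType)
    (P : probability T R) (Y : T -> E1) (Z : T -> E2) : Prop :=
  forall (A : set E1) (B : set E2), measurable A -> measurable B ->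
    P (Y @^-1` A `&` Z @^-1` B) = (P (Y @^-1` A) * P (Z @^-1` B))%E.

Section Measurements.
Context (R : realType) (d : measure_display) (D : BDS R d).

Definition bds_restr (a' a : {fset IDs}) (sub : (a' `<=` a)%fset) :
  D a -> D a' := bds_map D (fincl_inj (AsubB:=sub)).

Section Measurement.
Context d' (T : measurableType d') (P : probability T R).
Context (X : forall a : {fset IDs}, {RV P >-> D a}).

Definition exchangeable_measurement : Prop :=
  (forall (a' a : {fset IDs}) (sub : (a' `<=` a)%fset),
     {ae P, forall w, bds_restr sub (X a w) = X a' w}) /\
  (forall (a : {fset IDs}) (p : a -> a) (p_bij : bijective p),
     distrib_eq P (bds_map D (bij_inj p_bij) \o X a) (X a)).

End Measurement.

Definition bds_prod : Type := forall a : {fset IDs}, D a.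

(* D_N, as a subset of the product *)
Definition bds_lim : set bds_prod :=
  [set x | forall (a' a : {fset IDs}) (sub : (a' `<=` a)%fset),
     bds_restr sub (x a) = x a'].

(* The sigma-field on D_N generated by the coordinate maps *)
Definition bds_lim_measurable : set (set bds_prod) :=
  <<s bds_lim, \bigcup_(a in [set: {fset IDs}])
     preimage_set_system bds_lim (fun x : bds_prod => x a) measurable >>.

Definition restr_img (p : IDs -> IDs) (b : {fset IDs}) :
    b -> [fset p i | i in b]%fset :=
  fun i => [` in_imfset imfset_key p (valP i)]%fset.

Lemma restr_img_inj (p : IDs -> IDs) (b : {fset IDs}) :
  injective p -> injective (@restr_img p b).
Proof. by move=> p_inj i j /(congr1 val) /= /p_inj /val_inj. Qed.

(* D[p] for a bijection p of N; it maps D_N to itself. *)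
Definition bds_act (p : IDs -> IDs) (p_bij : bijective p) (x : bds_prod) :
    bds_prod :=
  fun b => bds_map D (@restr_img_inj p b (bij_inj p_bij))
             (x [fset p i | i in b]%fset).

Definition bds_invariant : set (set bds_prod) :=
  [set M | bds_lim_measurable M /\
     forall (p : IDs -> IDs) (p_bij : bijective p),
       finite_set [set i | p i <> i] -> bds_act p_bij @` M = M].

Section Properties.
Context d' (T : measurableType d') (P : probability T R).
Context (X : forall a : {fset IDs}, {RV P >-> D a}).

(* X takes its values in D_N only almost surely; for M included in D_N, the
   event [X \in M] includes that the values of X at w are compatible. *)
Definition ergodic : Prop :=
  forall M : set bds_prod, bds_invariant M ->
    P [set w | M (fun a => X a w)] = 0%E \/
    P [set w | M (fun a => X a w)] = 1%E.

Definition independence_property : Prop :=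
  forall a b : {fset IDs}, [disjoint a & b]%fset -> independent_RV P (X a) (X b).

End Properties.

Definition injections (b a : finType) : Type :=
  {t : {ffun b -> a} | injectiveb t}.

Definition injections_inj (b a : finType) (t : injections b a) :
  injective (val t) := elimT (injectiveP _) (valP t).
Arguments injections_inj {b a} t.

(* Only meaningful for k <= n; it is 0 otherwise, the sum being empty. *)
Definition avg (k : nat) (g : D (initseg k) -> R) (n : nat)
    (x : D (initseg n)) : R :=
  (n - k)`!%:R / n`!%:R *
  \sum_(t : injections (initseg k) (initseg n))
     g (bds_map D (injections_inj t) x).

(* The union of the function spaces R^(D_[k]) is a disjoint one: its elements
   are pairs of k and g. *)
Definition deterministic_approximation d' (T : measurableType d')
    (P : probability T R) (X : forall a : {fset IDs}, {RV P >-> D a}) : Prop :=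
  forall G : set {k : nat & D (initseg k) -> R},
    countable G ->
    (forall (k : nat) (g : D (initseg k) -> R), G (existT _ k g) ->
       measurable_fun setT g /\ exists C : R, forall y, `|g y| <= C) ->
    exists (m : nat -> nat) (x : forall n, D (initseg (m n))),
      (m @ \oo --> \oo) /\
      forall (k : nat) (g : D (initseg k) -> R), G (existT _ k g) ->
        (avg g (x n))%:E @[n --> \oo] --> ('E_P[g \o X (initseg k)])%E.

End Measurements.

(* Main.v *)
(* Write A_n g for the average of g over all injections into [n], applied to the
   data on [n].  A uniformly random permutation of [n] moves a fixed finite set
   off another one up to probability O(1/n); hence E[A_n g * h] converges, at
   rate O(1/n), to the expectation of g times h computed on disjoint ID sets.
   Moreover E[A_n g * A_m g] = E[(A_n g)^2] for m <= n, as A_n g is invariant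
   under permutations of [n].  So A_n g is Cauchy in L^2, without any reverse
   martingale theorem, and each property is shown to be equivalent to the
   factorization of expectations over disjoint ID sets:
   - factorization makes Var(A_n g) vanish, which yields deterministic points
     with the right averages, and decorrelates invariant events from every
     X_a, hence from themselves;
   - on deterministic points, (A_n g)(A_n h) - A_n (g h) = O(1/n) pointwise, so
     the factorization passes to the limit;
   - along n_j ~ 4^j the averages converge almost surely; their upper limit is
     an invariant function, hence constant if X is ergodic. *)

Require Import Defs.
From HB Require Import structures.
From mathcomp Require Import all_boot all_order all_algebra all_fingroup.
From mathcomp Require Import finmap.
From mathcomp Require Import all_classical all_reals all_analysis measurable_realfun.
From mathcomp Require Import ring lra.

Set Implicit Arguments.
Unset Strict Implicit.
Unset Printing Implicit Defensive.

Import Order.TTheory GRing.Theory Num.Theory.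
Import numFieldNormedType.Exports.

Local Open Scope classical_set_scope.
Local Open Scope ring_scope.

(** * Finite means and random permutations *)

Section FiniteMeans.
Context {R : realFieldType}.

(** The factorization over disjoint ID sets serves as the hub because it concerns bounded functions
    of finitely many IDs: it is stable under limits, and exchangeability makes both of its sides
    independent of the places where the functions are evaluated. Disjointness is encoded by the sum
    type: as a data structure accepts every finite type, a function on [D (b + c)] describes two
    disjoint blocks without naming IDs. Ergodicity, in contrast, concerns events of the whole
    family, which is compatible only almost surely. As there are countably many pairs of finite ID
    sets and diagonals of Borel spaces are measurable, compatibility is a measurable event of
    probability 1; invariant events are then reached from cylinders by uniqueness of finite
    measures. The growth 4^j comes from the second moments: squared L^2 increments are O(4^-j), so
    L^1 increments are O(2^-j) and summable. *)

Definition mean (J : finType) (F : J -> R) : R := (\sum_j F j) / #|J|%:R.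

Lemma mean_const (J : finType) (c : R) : (0 < #|J|)%N ->
  mean (fun _ : J => c) = c.
Proof.
move=> J0; rewrite /mean sumr_const -[_ *+ _]mulr_natr mulfK// pnatr_eq0 -lt0n//.
Qed.

Lemma eq_mean (J : finType) (F G : J -> R) : F =1 G -> mean F = mean G.
Proof. by move=> FG; rewrite /mean (eq_bigr _ (fun j _ => FG j)). Qed.

Lemma mean_reindex (J : finType) (h : J -> J) (F : J -> R) : bijective h ->
  mean (F \o h) = mean F.
Proof.
by move=> hb; rewrite /mean [in RHS](reindex h)//; exact: onW_bij.
Qed.

Lemma mean_exchange (J K : finType) (F : J -> K -> R) :
  mean (fun j => mean (F j)) = mean (fun k => mean (F^~ k)).
Proof. by rewrite /mean -!mulr_suml exchange_big/= mulrAC. Qed.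

Lemma meanZr (J : finType) (F : J -> R) (c : R) :
  mean (fun j => F j * c) = mean F * c.
Proof. by rewrite /mean -mulr_suml mulrAC. Qed.

Lemma ler_norm_mean (J : finType) (F : J -> R) (C : R) : 0 <= C ->
  (forall j, `|F j| <= C) -> `|mean F| <= C.
Proof.
move=> C0 FC; have [/eqP J0|J0] := boolP (#|J| == 0)%N.
  by rewrite /mean J0 invr0 mulr0 normr0.
rewrite /mean normrM normfV (ger0_norm (ler0n _ _)) ler_pdivrMr ?ltr0n ?lt0n//.
rewrite (le_trans (ler_norm_sum _ _ _))// (le_trans (ler_sum _ (fun j _ => FC j)))//.
by rewrite sumr_const mulr_natr.
Qed.

End FiniteMeans.

Section Permutations.

(** Transitivity of the permutation group on injections, through which every use of exchangeability
    passes. *)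
Lemma inj_extend_perm (b a : finType) (u v : b -> a) :
  injective u -> injective v ->
  exists kappa : {perm a}, forall i, kappa (u i) = v i.
Proof.
move=> ui vi.
(* Two enumerations of a, starting with the images of u and of v in the same order; the permutation
   matches them entry by entry. *)
pose s := codom u ++ [seq x <- enum a | x \notin codom u].
pose t := codom v ++ [seq x <- enum a | x \notin codom v].
have uniqst (w : b -> a) : injective w ->
    uniq (codom w ++ [seq x <- enum a | x \notin codom w]) /\
    (codom w ++ [seq x <- enum a | x \notin codom w]) =i a.
  move=> wi; split.
    rewrite cat_uniq filter_uniq ?enum_uniq// map_inj_uniq ?enum_uniq// andbT /=.
    by apply/hasPn => x; rewrite mem_filter => /andP[].
  by move=> x; rewrite mem_cat mem_filter mem_enum; case: (x \in codom w).
have [us ms] := uniqst u ui; have [ut mt] := uniqst v vi.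
have szst : size s = size t.
  by apply/perm_size/uniq_perm => // x; rewrite ms mt.
case: (pickP a) => [x0 _|a0]; last first.
  by exists 1%g => i; have := a0 (u i).
pose k x := nth x0 t (index x s).
have ki : injective k.
  move=> x y /eqP; rewrite nth_uniq -?szst ?index_mem ?ms// => /eqP exy.
  by rewrite -(nth_index x0 (_ : x \in s)) ?ms// exy nth_index// ms.
exists (perm ki) => i; rewrite permE /k index_cat codom_f.
have -> : index (u i) (codom u) = index i (enum b) by rewrite index_map.
rewrite nth_cat size_map index_mem mem_enum (nth_map i) ?index_mem ?mem_enum//.
by rewrite nth_index// mem_enum.
Qed.

(** Right multiplication by [tperm y z] carries the permutations with p x = y onto those with p x =
    z, so all fibres of the evaluation at x have the same size. *)
Lemma card_perm_point (I : finType) (x y : I) :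
  (#|[pred p : {perm I} | p x == y]| * #|I|)%N = #|{perm I}|.
Proof.
rewrite -[RHS]sum1_card (partition_big (fun p : {perm I} => p x) predT)//=.
rewrite (eq_bigr (fun=> #|[pred p : {perm I} | p x == y]|)); last first.
  move=> z _; rewrite sum1_card.
  rewrite -[RHS](fintype.card_image (mulIg (tperm y z))); apply: eq_card => p.
  rewrite unfold_in /=; apply/eqP/fintype.imageP => [pxz|[q /eqP qx ->]].
    exists (p * tperm y z)%g; last by rewrite -mulgA tperm2 mulg1.
    by rewrite inE permM pxz tpermR.
  by rewrite permM qx tpermL.
by rewrite sum_nat_const mulnC.
Qed.

(* Under a uniformly random permutation of I, the image of s meets the one of
   t with probability at most #|a| #|b| / #|I|. *)
Lemma mean_perm_approx (R : realFieldType) (I a b : finType) (s : a -> I)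
    (t : b -> I) (K : {perm I} -> R) (kappa C : R) :
  (0 < #|I|)%N ->
  (forall p, `|K p - kappa| <= C) ->
  (forall p : {perm I}, (forall i j, p (s i) <> t j) -> K p = kappa) ->
  `|mean K - kappa| <= C * #|a|%:R * #|b|%:R / #|I|%:R.
Proof.
move=> I0 KC Kk; have C0 : 0 <= C by apply: le_trans (KC 1%g).
have P0 : (0 < #|{perm I}|)%N by apply/card_gt0P; exists 1%g.
have PR : #|{perm I}|%:R != 0 :> R by rewrite pnatr_eq0 -lt0n.
have -> : mean K - kappa = mean (fun p => K p - kappa).
  rewrite /mean sumrB mulrBl; congr (_ - _).
  by rewrite -[LHS](@mean_const _ {perm I}).
(* A union bound over the pairs (i, j): each pair collides for a fraction 1/#|I| of all
   permutations, by [card_perm_point]. *)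
have Kle p : `|K p - kappa| <= \sum_i \sum_j C * (p (s i) == t j)%:R.
  have [/existsP[i /existsP[j pij]]|npij] :=
      boolP [exists i, [exists j, p (s i) == t j]].
    rewrite (bigD1 i)//= (bigD1 j)//= pij mulr1 -addrA.
    rewrite (le_trans (KC p))// lerDl addr_ge0// ?sumr_ge0// => *.
      by rewrite mulr_ge0.
    by rewrite sumr_ge0// => *; rewrite mulr_ge0.
  rewrite Kk ?subrr ?normr0; last first.
    move=> i j pij; move/existsP: npij; apply.
    by exists i; apply/existsP; exists j; apply/eqP.
  by rewrite sumr_ge0// => *; rewrite sumr_ge0// => *; rewrite mulr_ge0.
rewrite /mean normrM normfV (ger0_norm (ler0n _ _)).
rewrite ler_pdivrMr ?ltr0n//.
apply: le_trans (ler_norm_sum _ _ _) _.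
apply: le_trans (ler_sum _ (fun p _ => Kle p)) _.
rewrite exchange_big/= (eq_bigr (fun _ => \sum_(j : b) C * (#|{perm I}|%:R / #|I|%:R))).
  rewrite !sumr_const -[leLHS]mulr_natr -[X in X * _]mulr_natr.
  by rewrite le_eqVlt; apply/orP; left; apply/eqP; ring.
move=> i _; rewrite exchange_big/=; apply: eq_bigr => j _.
rewrite -mulr_sumr -natr_sum -(card_perm_point (s i) (t j)) natrM.
rewrite mulfK ?pnatr_eq0 -?lt0n//.
congr (_ * _%:R); rewrite -sum1_card big_mkcond/= [RHS]big_mkcond/=.
by apply: eq_bigr => p _; rewrite inE; case: (_ == _).
Qed.

End Permutations.

(** * Bounded measurable functions *)

Definition bounded_measurable d (T : measurableType d) (R : realType)
    (f : T -> R) : Prop :=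
  measurable_fun setT f /\ exists C : R, forall x, `|f x| <= C.

Section BoundedMeasurable.
Context d (T : measurableType d) (R : realType).
Implicit Types f g : T -> R.

Lemma bounded_measurable_cst (c : R) : bounded_measurable (fun _ : T => c).
Proof. by split; [exact: measurable_cst|exists `|c|]. Qed.

Lemma bounded_measurableD f g : bounded_measurable f -> bounded_measurable g ->
  bounded_measurable (fun x => f x + g x).
Proof.
move=> [mf [C fC]] [mg [C' gC]]; split; first exact: measurable_funD.
by exists (C + C') => x; rewrite (le_trans (ler_normD _ _))// lerD.
Qed.

Lemma bounded_measurableM f g : bounded_measurable f -> bounded_measurable g ->
  bounded_measurable (fun x => f x * g x).
Proof.
move=> [mf [C fC]] [mg [C' gC]]; split; first exact: measurable_funM.
by exists (C * C') => x; rewrite normrM ler_pM.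
Qed.

Lemma bounded_measurableB f g : bounded_measurable f -> bounded_measurable g ->
  bounded_measurable (fun x => f x - g x).
Proof.
move=> [mf [C fC]] [mg [C' gC]]; split; first exact: measurable_funB.
by exists (C + C') => x; rewrite (le_trans (ler_normB _ _))// lerD.
Qed.

Lemma bounded_measurable_norm f : bounded_measurable f ->
  bounded_measurable (fun x => `|f x|).
Proof.
move=> [mf [C fC]]; split; first exact: measurableT_comp.
by exists C => x; rewrite normr_id.
Qed.

Lemma bounded_measurable_sum (J : Type) (r : seq J) (F : J -> T -> R) :
  (forall j, bounded_measurable (F j)) ->
  bounded_measurable (fun x => \sum_(j <- r) F j x).
Proof.
move=> bF; elim: r => [|j r IH].
  under eq_fun do rewrite big_nil; exact: bounded_measurable_cst.
under eq_fun do rewrite big_cons; exact: bounded_measurableD.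
Qed.

Lemma bounded_measurable_mean (J : finType) (F : J -> T -> R) :
  (forall j, bounded_measurable (F j)) ->
  bounded_measurable (fun x => mean (F^~ x)).
Proof.
move=> bF; apply: bounded_measurableM; last exact: bounded_measurable_cst.
exact: bounded_measurable_sum.
Qed.

Lemma bounded_measurable_comp d' (T' : measurableType d') (Y : T' -> T) f :
  measurable_fun setT Y -> bounded_measurable f ->
  bounded_measurable (fun x => f (Y x)).
Proof.
move=> mY [mf [C fC]]; split; first exact: measurableT_comp.
by exists C => x; exact: fC.
Qed.

Lemma bounded_measurable_indic (A : set T) : measurable A ->
  bounded_measurable (\1_A : T -> R).
Proof.
move=> mA; split; first exact: measurable_indic.
by exists 1 => x; rewrite indicE; case: (x \in A); rewrite ?normr1 ?normr0.
Qed.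

End BoundedMeasurable.

Section Expectation.
Context d (T : measurableType d) (R : realType) (P : probability T R).
Implicit Types f g : T -> R.
Local Notation Ex f := (Rintegral P setT f).

Lemma bounded_measurable_integrable f : bounded_measurable f ->
  P.-integrable setT (EFin \o f).
Proof.
move=> [mf [C fC]]; apply: measurable_bounded_integrable => //.
  by rewrite fin_num_fun_lty//; exact: fin_num_measure.
exists C; split; first exact: num_real.
by move=> M CM x _ /=; rewrite (le_trans (fC x))// ltW.
Qed.
Local Hint Resolve bounded_measurable_integrable : core.

Lemma expectation_Rintegral f : bounded_measurable f -> 'E_P[f]%E = (Ex f)%:E.
Proof.
move=> bf; rewrite unlock /Rintegral fineK//.
exact: (integrable_fin_num _ (bounded_measurable_integrable bf)).
Qed.

Lemma Rintegral_cstT (c : R) : Ex (fun=> c) = c.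
Proof.
rewrite Rintegral_cst// -[RHS]mulr1; congr (_ * _).
by have /(congr1 fine) := probability_setT P.
Qed.

Lemma le_RintegralT f g : bounded_measurable f -> bounded_measurable g ->
  (forall x, f x <= g x) -> Ex f <= Ex g.
Proof.
by move=> bf bg fg; apply: le_Rintegral => //;
  exact: bounded_measurable_integrable.
Qed.

Lemma Rintegral_sum (J : Type) (r : seq J) (F : J -> T -> R) :
  (forall j, bounded_measurable (F j)) ->
  Ex (fun x => \sum_(j <- r) F j x) = \sum_(j <- r) Ex (F j).
Proof.
move=> bF; elim: r => [|j r IH].
  by under eq_Rintegral do rewrite big_nil; rewrite Rintegral_cstT big_nil.
under eq_Rintegral do rewrite big_cons; rewrite big_cons -IH.
apply: RintegralD => //; apply: bounded_measurable_integrable => //.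
exact: bounded_measurable_sum.
Qed.

Lemma Rintegral_mean (J : finType) (F : J -> T -> R) :
  (forall j, bounded_measurable (F j)) ->
  Ex (fun x => mean (F^~ x)) = mean (fun j => Ex (F j)).
Proof.
move=> bF; rewrite /mean RintegralZr//; first by rewrite Rintegral_sum.
by apply: bounded_measurable_integrable; exact: bounded_measurable_sum.
Qed.

Lemma Rintegral_norm_le f (C : R) : bounded_measurable f ->
  (forall x, `|f x| <= C) -> `|Ex f| <= C.
Proof.
move=> bf fC; apply: le_trans (le_normr_Rintegral _ _) _ => //.
  exact: bounded_measurable_integrable.
rewrite -[leRHS]Rintegral_cstT; apply: le_RintegralT => //.
  exact: bounded_measurable_norm.
exact: bounded_measurable_cst.
Qed.

Lemma ae_eq_Rintegral f g : bounded_measurable f -> bounded_measurable g ->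
  {ae P, forall x, f x = g x} -> Ex f = Ex g.
Proof.
move=> [mf _] [mg _] fg; congr fine; apply: ae_eq_integral => //.
- exact/measurable_EFinP.
- exact/measurable_EFinP.
by apply: filterS fg => x /= -> _.
Qed.

Lemma Rintegral_indicT (A : set T) : measurable A -> Ex \1_A = fine (P A).
Proof. by move=> mA; rewrite /Rintegral integral_indic// setIT. Qed.

(** The first moment method: it turns a bound on an expectation into a deterministic sample
    point. *)
Lemma Rintegral_lt_exists f (c : R) : bounded_measurable f -> Ex f < c ->
  exists w, f w < c.
Proof.
move=> bf; apply: contraPP => /forallNP nf; apply/negP; rewrite -leNgt.
rewrite -[leLHS]Rintegral_cstT; apply: le_RintegralT => //.
  exact: bounded_measurable_cst.
by move=> x; rewrite leNgt; apply/negP; exact: nf.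
Qed.

Section Laws.
Context d' (E : measurableType d').

Lemma Rintegral_distrib_eq (Y Z : T -> E) (g : E -> R) :
  measurable_fun setT Y -> measurable_fun setT Z ->
  distrib_eq P Y Z -> bounded_measurable g ->
  Ex (fun w => g (Y w)) = Ex (fun w => g (Z w)).
Proof.
move=> mY mZ YZ bg; congr fine.
have mg : measurable_fun setT (EFin \o g) by apply/measurable_EFinP; case: bg.
have ig (V : T -> E) : measurable_fun setT V ->
    P.-integrable (V @^-1` setT) ((EFin \o g) \o V).
  move=> mV; rewrite preimage_setT.
  exact/bounded_measurable_integrable/bounded_measurable_comp.
transitivity (\int[pushforward P Y]_y (g y)%:E)%E.
  by rewrite (integral_pushforward mY mg (ig _ mY) measurableT) preimage_setT.
transitivity (\int[pushforward P Z]_y (g y)%:E)%E.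
  by apply: eq_measure_integral => A mA _; exact: YZ.
by rewrite (integral_pushforward mZ mg (ig _ mZ) measurableT) preimage_setT.
Qed.

End Laws.

End Expectation.

Section Independence.
Context d (T : measurableType d) (R : realType) (P : probability T R).
Context d1 (E1 : measurableType d1) d2 (E2 : measurableType d2).
Variables (Y : {RV P >-> E1}) (Z : {RV P >-> E2}).

(** Rectangles determine the joint law of Y and Z as the product of their laws, and Fubini's theorem
    splits the integral. *)
Lemma Rintegral_independent (g : E1 -> R) (h : E2 -> R) :
  independent_RV P Y Z -> bounded_measurable g -> bounded_measurable h ->
  Rintegral P setT (fun w => g (Y w) * h (Z w)) =
  Rintegral P setT (fun w => g (Y w)) * Rintegral P setT (fun w => h (Z w)).
Proof.
move=> YZ bg bh.
pose W w := (Y w, Z w); pose f (z : E1 * E2) := g z.1 * h z.2.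
have mW : measurable_fun setT W by exact: measurable_fun_pair.
have bf : bounded_measurable f.
  apply: bounded_measurableM.
    exact: (bounded_measurable_comp (measurable_fst)).
  exact: (bounded_measurable_comp (measurable_snd)).
have mf : measurable_fun setT (EFin \o f) by apply/measurable_EFinP; case: bf.
pose PY : probability E1 R := distribution P Y.
pose PZ : probability E2 R := distribution P Z.
have prodE A : measurable A -> (PY \x PZ)%E A = pushforward P W A.
  apply: product_measure_unique => A1 A2 mA1 mA2.
  by rewrite /pushforward; exact: YZ.
have iW : P.-integrable (W @^-1` setT) ((EFin \o f) \o W).
  rewrite preimage_setT.
  exact/bounded_measurable_integrable/(bounded_measurable_comp mW).
(* Integrability is known for the joint law and carries over because the two measures agree on
   measurable sets. *)
have if1 : (PY \x PZ)%E.-integrable setT (EFin \o f).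
  have /integrableP[_ foo] := integrable_pushforward mW mf iW measurableT.
  apply/integrableP; split => //; apply: le_lt_trans foo.
  rewrite le_eqVlt; apply/orP; left; apply/eqP.
  by apply: eq_measure_integral => A mA _; exact: prodE.
have EY : Rintegral P setT (fun w => g (Y w)) = Rintegral PY setT g.
  congr fine; rewrite integral_distribution//.
    by apply/measurable_EFinP; case: bg.
  exact/bounded_measurable_integrable/bounded_measurable_comp.
have EZ : Rintegral P setT (fun w => h (Z w)) = Rintegral PZ setT h.
  congr fine; rewrite integral_distribution//.
    by apply/measurable_EFinP; case: bh.
  exact/bounded_measurable_integrable/bounded_measurable_comp.
rewrite EY EZ -RintegralZr//; last exact: bounded_measurable_integrable.
congr fine.
transitivity (\int[pushforward P W]_z (f z)%:E)%E.
  by rewrite (integral_pushforward mW mf iW measurableT) preimage_setT.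
transitivity (\int[(PY \x PZ)%E]_z (f z)%:E)%E.
  by apply: eq_measure_integral => A mA _; rewrite /= prodE.
rewrite -(integral12_prod_meas1 if1); apply: eq_integral => x _ /=.
rewrite /f /= [in RHS]EFinM.
rewrite /Rintegral fineK; last first.
  by apply: integrable_fin_num => //; exact: bounded_measurable_integrable.
rewrite -integralZl//; last exact: bounded_measurable_integrable.
Qed.

End Independence.

(** * Averages over permutations *)

Section BDSTheory.
Context (R : realType) (d : measure_display) (D : BDS R d).

Lemma bds_map_ext (b a : finType) (t t' : b -> a) (ti : injective t)
    (ti' : injective t') (x : D a) :
  t =1 t' -> bds_map D ti x = bds_map D ti' x.
Proof.
move=> /funext tt'; case: _ / tt' in ti' *.
by rewrite (Prop_irrelevance ti ti').
Qed.

(** The free [r] lets functoriality apply to any presentation of the composite map, whatever its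
    injectivity proof. *)
Lemma bds_map_trans (c b a : finType) (s : b -> a) (t : c -> b) (r : c -> a)
    (si : injective s) (ti : injective t) (ri : injective r) (x : D a) :
  r =1 s \o t -> bds_map D ti (bds_map D si x) = bds_map D ri x.
Proof. by move=> rst; rewrite -bds_map_comp; apply: bds_map_ext. Qed.

Lemma bds_map_id1 (a : finType) (t : a -> a) (ti : injective t) (x : D a) :
  t =1 id -> bds_map D ti x = x.
Proof. by move=> t1; rewrite -[RHS](@bds_map_id _ _ D); exact: bds_map_ext. Qed.

(** The average over all injections, written over the permutation group along one reference
    injection: invariance then becomes a reindexing by multiplication, and the O(1/n) errors become
    counts of permutations. [avgE] reconciles the two forms. *)
Definition perm_avg (b a : finType) (s : b -> a) (si : injective s)
    (g : D b -> R) (x : D a) : R :=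
  mean (fun p : {perm a} => g (bds_map D (inj_comp (@perm_inj _ p) si) x)).

Section PermAvg.
Context (b a : finType) (s : b -> a) (si : injective s) (g : D b -> R).

Lemma perm_avg_map (k : a -> a) (ki : injective k) (x : D a) :
  perm_avg si g (bds_map D ki x) = perm_avg si g x.
Proof.
rewrite /perm_avg.
rewrite -[RHS](mean_reindex (h := fun p : {perm a} => (p * perm ki)%g)); last first.
  exact: (Bijective (mulgK _) (mulgKV _)).
apply: eq_mean => p /=; congr g; apply: bds_map_trans => i /=.
by rewrite permM permE.
Qed.

Lemma perm_avg_inj (s' : b -> a) (si' : injective s') (x : D a) :
  perm_avg si g x = perm_avg si' g x.
Proof.
have [k ks] := inj_extend_perm si si'.
rewrite /perm_avg -[LHS](mean_reindex (h := fun p : {perm a} => (k * p)%g)); last first.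
  exact: (Bijective (mulKg _) (mulKVg _)).
apply: eq_mean => p /=; congr g; apply: bds_map_ext => i /=.
by rewrite permM ks.
Qed.

Lemma perm_avg_bounded (C : R) (x : D a) :
  (forall y, `|g y| <= C) -> `|perm_avg si g x| <= C.
Proof.
move=> gC; apply: ler_norm_mean => //.
by apply: le_trans (gC (bds_map D si x)).
Qed.

Lemma bounded_measurable_perm_avg : bounded_measurable g ->
  bounded_measurable (perm_avg si g).
Proof.
move=> bg; apply: bounded_measurable_mean => p.
exact: bounded_measurable_comp (bds_measurable _) bg.
Qed.

End PermAvg.

(** * Products of functions over disjoint unions *)

Definition sum_fun (A B C : Type) (s : A -> C) (t : B -> C) (z : A + B) : C :=
  match z with inl i => s i | inr j => t j end.

Lemma sum_fun_inj (A B C : Type) (s : A -> C) (t : B -> C) :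
  injective s -> injective t -> (forall i j, s i <> t j) ->
  injective (sum_fun s t).
Proof.
move=> si ti st [i|j] [i'|j'] /=; first by move=> /si ->.
- by move/st.
- by move/esym/st.
- by move=> /ti ->.
Qed.

Definition inl_inj (A B : Type) : injective (@inl A B).
Proof. by move=> x y []. Qed.

Definition inr_inj (A B : Type) : injective (@inr A B).
Proof. by move=> x y []. Qed.

(** The tensor product of g and h, evaluated on the restrictions of one datum to the two blocks of
    the disjoint union. *)
Definition tensor (b c : finType) (g : D b -> R) (h : D c -> R)
    (y : D (b + c)%type) : R :=
  g (bds_map D (@inl_inj b c) y) * h (bds_map D (@inr_inj b c) y).

Lemma bounded_measurable_tensor (b c : finType) (g : D b -> R) (h : D c -> R) :
  bounded_measurable g -> bounded_measurable h ->
  bounded_measurable (tensor g h).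
Proof.
by move=> bg bh; apply: bounded_measurableM; apply: bounded_measurable_comp;
  rewrite //; apply: bds_measurable.
Qed.

Lemma tensor_map (b c a : finType) (g : D b -> R) (h : D c -> R)
    (s : b -> a) (t : c -> a) (r : b + c -> a) (si : injective s) (ti : injective t)
    (ri : injective r) (x : D a) : r =1 sum_fun s t ->
  tensor g h (bds_map D ri x) = g (bds_map D si x) * h (bds_map D ti x).
Proof.
by move=> rst; congr (g _ * h _); apply: bds_map_trans => i /=; rewrite rst.
Qed.

(** Averages ignore a permutation of x, so the product is a mean over p of joint averages in which s
    is moved by p. When p moves s off t, the joint average equals that of the tensor; both are
    bounded by C C', whence the factor 2. *)
Lemma perm_avg_mul_approx (b c a : finType) (s : b -> a) (t : c -> a)
    (si : injective s) (ti : injective t) (sti : injective (sum_fun s t))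
    (g : D b -> R) (h : D c -> R) (C C' : R) (x : D a) :
  (0 < #|a|)%N ->
  (forall y, `|g y| <= C) -> (forall y, `|h y| <= C') ->
  `|perm_avg si g x * perm_avg ti h x - perm_avg sti (tensor g h) x| <=
     (2 * C * C') * #|b|%:R * #|c|%:R / #|a|%:R.
Proof.
move=> a0 gC hC.
pose K (p : {perm a}) := mean (fun q : {perm a} =>
  g (bds_map D (inj_comp (@perm_inj _ q) (inj_comp (@perm_inj _ p) si)) x) *
  h (bds_map D (inj_comp (@perm_inj _ q) ti) x)).
have C0 : 0 <= C by exact: le_trans (gC (bds_map D si x)).
have C'0 : 0 <= C' by exact: le_trans (hC (bds_map D ti x)).
have -> : perm_avg si g x * perm_avg ti h x = mean K.
  rewrite mean_exchange /= mulrC /perm_avg -meanZr; apply: eq_mean => q.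
  rewrite mulrC meanZr; congr (_ * _).
  rewrite -[LHS](@perm_avg_map _ _ _ _ _ _ (@perm_inj _ q)).
  by apply: eq_mean => p; congr g; apply: bds_map_trans.
apply: (mean_perm_approx (s := s) (t := t)) => // p.
  rewrite (le_trans (ler_normB _ _))// (_ : 2 * C * C' = C * C' + C * C'); last by ring.
  apply: lerD.
    apply: ler_norm_mean => [|q]; first exact: mulr_ge0.
    by rewrite normrM ler_pM.
  by apply: perm_avg_bounded => y; rewrite normrM ler_pM.
move=> pst.
have pi : injective (sum_fun (p \o s) t).
  apply: sum_fun_inj => //; exact: (inj_comp (@perm_inj _ p) si).
rewrite (perm_avg_inj sti _ pi); apply: eq_mean => q.
by rewrite (tensor_map _ _ (inj_comp (@perm_inj _ q) (inj_comp (@perm_inj _ p) si))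
   (inj_comp (@perm_inj _ q) ti)) // => -[].
Qed.

End BDSTheory.

Section InitialSegments.

Lemma in_initseg (k : nat) (i : IDs) : (i \in initseg k) = (sval i <= k)%N.
Proof.
apply/imfsetP/idP => [[j /=]|].
  by rewrite mem_iota add0n => /andP[_ jk] ->.
case: i => [[//|i] i0] /= ik; exists i; first by rewrite /= mem_iota.
exact: val_inj.
Qed.

Lemma card_initseg (k : nat) : #|{: initseg k}| = k.
Proof.
rewrite -cardfE card_imfset /=; last by move=> i j /(congr1 val) /= [].
by rewrite undup_id ?iota_uniq// size_iota.
Qed.

Lemma initseg_sub (m n : nat) : (m <= n)%N -> (initseg m `<=` initseg n)%fset.
Proof.
by move=> mn; apply/fsubsetP => i; rewrite !in_initseg => /leq_trans; apply.
Qed.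

Lemma fset_sub_initseg (a : {fset IDs}) : exists n, (a `<=` initseg n)%fset.
Proof.
exists (\max_(i : a) sval (val i)); apply/fsubsetP => i ia.
by rewrite in_initseg (leq_bigmax (F := fun i : a => sval (val i)) [` ia]%fset).
Qed.

End InitialSegments.

(** * Averages over injections as averages over permutations *)

Section AvgPermAvg.
Context (R : realType) (d : measure_display) (D : BDS R d).

(** Composition with a permutation p permutes the injections, so the mean over injections may also
    be averaged over p. After exchanging the two means, the inner one is [perm_avg] along t, which
    does not depend on t. *)
Lemma avgE (k n : nat) (s : initseg k -> initseg n) (si : injective s)
    (g : D (initseg k) -> R) (x : D (initseg n)) :
  avg g x = perm_avg si g x.
Proof.
have kn : (k <= n)%N by rewrite -(card_initseg k) -(card_initseg n) (leq_card _ si).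
pose J : finType := {t : {ffun initseg k -> initseg n} | injectiveb t}.
have cardJ : #|J| = (n ^_ k)%N.
  have := card_inj_ffuns (initseg k) (initseg n); rewrite !card_initseg => <-.
  rewrite card_sig; by rewrite cardsE.
pose G (t : J) := g (bds_map D (@injections_inj _ _ t) x).
have -> : avg g x = mean G.
  rewrite /avg mulrC /mean cardJ; congr (_ * _).
  by rewrite -(ffact_fact kn) natrM invfM mulrCA mulfV ?mulr1//
    pnatr_eq0 -lt0n fact_gt0.
have comp_inj (p : {perm initseg n}) (t : J) : injectiveb [ffun i => p (val t i)].
  by apply/injectiveP => i j; rewrite !ffunE => /perm_inj/(injections_inj (t := t)).
pose comp p t : J :=
  exist (fun u : {ffun _ -> _} => injectiveb u) _ (comp_inj p t).
have compE p t : G (comp p t) =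
    g (bds_map D (inj_comp (@perm_inj _ p) (@injections_inj _ _ t)) x).
  by congr g; apply: bds_map_ext => i /=; rewrite ffunE.
have compK p : cancel (comp p) (comp p^-1)%g.
  by move=> t; apply/val_inj/ffunP => i; rewrite /= !ffunE permK.
have -> : mean G = mean (fun p : {perm initseg n} => mean (fun t => G (comp p t))).
  rewrite [RHS](eq_mean (G := fun=> mean G)).
    have P0 : (0 < #|{perm initseg n}|)%N by apply/card_gt0P; exists 1%g.
    by rewrite mean_const.
  move=> p; apply: (mean_reindex (h := comp p)).
  by exists (comp p^-1)%g => //; rewrite -[X in cancel _ (comp X)]invgK.
rewrite mean_exchange (eq_mean (G := fun=> perm_avg si g x)); last first.
  move=> t; rewrite (perm_avg_inj si _ (@injections_inj _ _ t)).
  by apply: eq_mean => p; rewrite compE.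
by rewrite mean_const// cardJ ffact_gt0.
Qed.

End AvgPermAvg.

(** * Exchangeable measurements *)

Lemma inj_exists (b a : finType) : (#|b| <= #|a|)%N ->
  exists s : b -> a, injective s.
Proof.
move=> ba; exists (fun i => enum_val (widen_ord ba (enum_rank i))) => i j.
by move=> /enum_val_inj/(congr1 val)/= /val_inj/enum_rank_inj.
Qed.

Section Exchangeability.
Context (R : realType) (d : measure_display) (D : BDS R d).
Context d' (T : measurableType d') (P : probability T R).
Context (X : forall a : {fset IDs}, {RV P >-> D a}).
Hypothesis X_exch : exchangeable_measurement X.
Local Notation Ex f := (Rintegral P setT f).

Lemma ae_eq_probability (A B : set T) : measurable A -> measurable B ->
  {ae P, forall w, A w <-> B w} -> P A = P B.
Proof.
move=> mA mB AB.
suff : fine (P A) = fine (P B).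
  by move=> e; rewrite -[LHS]fineK ?fin_num_measure// e fineK// fin_num_measure.
rewrite -!Rintegral_indicT//; apply: ae_eq_Rintegral.
- exact: bounded_measurable_indic.
- exact: bounded_measurable_indic.
apply: filterS AB => w AB; rewrite !indicE; congr (nat_of_bool _)%:R.
by apply/idP/idP; rewrite !inE => /AB.
Qed.

Lemma bounded_measurable_X (b : finType) (a : {fset IDs}) (s : b -> a)
    (si : injective s) (g : D b -> R) : bounded_measurable g ->
  bounded_measurable (fun w => g (bds_map D si (X a w))).
Proof.
move=> bg; apply: (bounded_measurable_comp (Y := fun w => bds_map D si (X a w))) bg.
exact: measurableT_comp (bds_measurable _) _.
Qed.

Lemma X_fincl_ae (b : finType) (a c : {fset IDs}) (ac : (a `<=` c)%fset)
    (s : b -> a) (si : injective s) (r : b -> c) (ri : injective r) :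
  r =1 fincl ac \o s ->
  {ae P, forall w, bds_map D ri (X c w) = bds_map D si (X a w)}.
Proof.
move=> rs; have [Xr _] := X_exch; apply: filterS (Xr _ _ ac) => w <-.
by rewrite /bds_restr; apply/esym/bds_map_trans.
Qed.

(** Exchangeability only concerns bijections of a single set. Both injections are therefore followed
    into the union of a and a', where some permutation carries one to the other. *)
Lemma distrib_eq_map (b : finType) (a a' : {fset IDs})
    (s : b -> a) (s' : b -> a') (si : injective s) (si' : injective s') :
  distrib_eq P (fun w => bds_map D si (X a w)) (fun w => bds_map D si' (X a' w)).
Proof.
move=> A mA.
have mX (c : {fset IDs}) (r : b -> c) (ri : injective r) :
    measurable ((fun w => bds_map D ri (X c w)) @^-1` A).
  have mf : measurable_fun setT (fun w => bds_map D ri (X c w)).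
    exact: measurableT_comp (bds_measurable _) _.
  by rewrite -[X in measurable X]setTI; exact: mf.
pose c := (a `|` a')%fset.
have ac : (a `<=` c)%fset by exact: fsubsetUl.
have a'c : (a' `<=` c)%fset by exact: fsubsetUr.
have ri : injective (fincl ac \o s) by exact: inj_comp (@fincl_inj _ _ _ ac) si.
have ri' : injective (fincl a'c \o s') by exact: inj_comp (@fincl_inj _ _ _ a'c) si'.
transitivity (P ((fun w => bds_map D ri (X c w)) @^-1` A)).
  apply: ae_eq_probability => //.
  have := @X_fincl_ae _ _ _ ac _ si _ ri (fun=> erefl).
  by apply: filterS => w /= ->.
transitivity (P ((fun w => bds_map D ri' (X c w)) @^-1` A)); last first.
  apply: ae_eq_probability => //.
  have := @X_fincl_ae _ _ _ a'c _ si' _ ri' (fun=> erefl).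
  by apply: filterS => w /= ->.
have [k kr] := inj_extend_perm ri ri'.
have kb : bijective k by exact: injF_bij (@perm_inj _ k).
have [_ Xk] := X_exch.
have mDA : measurable (bds_map D ri @^-1` A).
  by rewrite -[X in measurable X]setTI; exact: bds_measurable.
rewrite -(Xk c k kb _ mDA); congr (P _).
apply/seteqP; split => w /=; rewrite (bds_map_trans _ _ ri')//.
- by move=> i /=; rewrite kr.
- by move=> i /=; rewrite kr.
Qed.

Lemma Rintegral_map (b : finType) (a a' : {fset IDs})
    (s : b -> a) (s' : b -> a') (si : injective s) (si' : injective s')
    (g : D b -> R) : bounded_measurable g ->
  Ex (fun w => g (bds_map D si (X a w))) = Ex (fun w => g (bds_map D si' (X a' w))).
Proof.
move=> bg; apply: (Rintegral_distrib_eq _ _ (distrib_eq_map si si') bg).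
- exact: measurableT_comp (bds_measurable _) _.
- exact: measurableT_comp (bds_measurable _) _.
Qed.

Lemma Rintegral_self_map (a : {fset IDs}) (k : a -> a) (ki : injective k)
    (F : D a -> R) : bounded_measurable F ->
  Ex (fun w => F (bds_map D ki (X a w))) = Ex (fun w => F (X a w)).
Proof.
move=> bF; rewrite (Rintegral_map ki (@inj_id _) bF).
by apply: eq_Rintegral => w _; rewrite bds_map_id.
Qed.

Section Averages.
Context (b : finType) (g : D b -> R) (bg : bounded_measurable g).

Lemma Rintegral_perm_avg (a a' : {fset IDs}) (s : b -> a) (si : injective s)
    (t : b -> a') (ti : injective t) :
  Ex (fun w => perm_avg si g (X a w)) = Ex (fun w => g (bds_map D ti (X a' w))).
Proof.
rewrite Rintegral_mean; last by move=> p; exact: bounded_measurable_X.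
rewrite (eq_mean (G := fun=> Ex (fun w => g (bds_map D ti (X a' w))))).
  by rewrite mean_const//; apply/card_gt0P; exists 1%g.
by move=> p; exact: Rintegral_map.
Qed.

(** A permutation of a that carries r to r' preserves the law of [X a] and leaves the average
    unchanged. *)
Lemma Rintegral_perm_avg_map (a : {fset IDs}) (s r r' : b -> a)
    (si : injective s) (ri : injective r) (ri' : injective r') :
  Ex (fun w => perm_avg si g (X a w) * g (bds_map D ri (X a w))) =
  Ex (fun w => perm_avg si g (X a w) * g (bds_map D ri' (X a w))).
Proof.
have [k kr] := inj_extend_perm ri ri'.
pose F (x : D a) := perm_avg si g x * g (bds_map D ri x).
have bF : bounded_measurable F.
  apply: bounded_measurableM; first exact: bounded_measurable_perm_avg.
  exact: bounded_measurable_comp (bds_measurable _) _.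
rewrite -(Rintegral_self_map (@perm_inj _ k) bF); apply: eq_Rintegral => w _.
rewrite /F perm_avg_map; congr (_ * g _); apply: bds_map_trans => i /=.
by rewrite kr.
Qed.

(* The larger average is a conditional expectation of the smaller one given
   the data that are invariant under permutations of the larger set. *)
Lemma Rintegral_perm_avgM (a c : {fset IDs}) (s : b -> a) (t : b -> c)
    (si : injective s) (ti : injective t) : (a `<=` c)%fset ->
  Ex (fun w => perm_avg ti g (X c w) * perm_avg si g (X a w)) =
  Ex (fun w => perm_avg ti g (X c w) * g (bds_map D ti (X c w))).
Proof.
move=> ac.
pose r (p : {perm a}) := fincl ac \o (p \o s).
have ri p : injective (r p).
  exact: inj_comp (@fincl_inj _ _ _ ac) (inj_comp (@perm_inj _ p) si).
have bA : bounded_measurable (fun w => perm_avg ti g (X c w)).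
  by apply: bounded_measurable_comp => //; exact: bounded_measurable_perm_avg.
have bgr p : bounded_measurable (fun w => g (bds_map D (ri p) (X c w))).
  exact: bounded_measurable_X.
(* Each summand of the smaller average is almost surely g along an injection into c; against the
   invariant factor all such injections have the same expectation. *)
transitivity (Ex (fun w => mean (fun p : {perm a} =>
    perm_avg ti g (X c w) * g (bds_map D (ri p) (X c w))))).
  apply: ae_eq_Rintegral.
  - apply: bounded_measurableM => //.
    by apply: bounded_measurable_comp => //; exact: bounded_measurable_perm_avg.
  - by apply: bounded_measurable_mean => p; exact: bounded_measurableM.
  have rae (p : {perm a}) : {ae P, forall w, bds_map D (ri p) (X c w) =
      bds_map D (inj_comp (@perm_inj _ p) si) (X a w)}.
    exact: X_fincl_ae.
  have : {ae P, forall w, forall p : {perm a}, bds_map D (ri p) (X c w) =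
      bds_map D (inj_comp (@perm_inj _ p) si) (X a w)}.
    exact: filter_forall.
  apply: filterS => w rw; rewrite /= mulrC -meanZr; apply: eq_mean => p.
  by rewrite mulrC rw.
rewrite (@Rintegral_mean _ _ _ P _ (fun p w =>
  perm_avg ti g (X c w) * g (bds_map D (ri p) (X c w)))); last first.
  by move=> p; exact: bounded_measurableM.
rewrite (eq_mean (G := fun=> Ex (fun w =>
  perm_avg ti g (X c w) * g (bds_map D ti (X c w))))).
  by rewrite mean_const//; apply/card_gt0P; exists 1%g.
by move=> p; exact: Rintegral_perm_avg_map.
Qed.

(** The counterpart of [perm_avg_mul_approx] in expectation: exchangeability takes over the
    averaging of the second factor. *)
Lemma Rintegral_perm_avg_approx (c : finType) (h : D c -> R) (C C' : R)
    (a : {fset IDs}) (s : b -> a) (t : c -> a) (r : b + c -> a)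
    (si : injective s) (ti : injective t) (ri : injective r) :
  (0 < #|{: a}|)%N ->
  bounded_measurable h ->
  (forall y, `|g y| <= C) -> (forall y, `|h y| <= C') ->
  `|Ex (fun w => perm_avg si g (X a w) * h (bds_map D ti (X a w))) -
    Ex (fun w => tensor g h (bds_map D ri (X a w)))| <=
  (2 * C * C') * #|b|%:R * #|c|%:R / #|{: a}|%:R.
Proof.
move=> a0 bh gC hC.
pose w0 : T := point.
have C0 : 0 <= C by exact: le_trans (gC (bds_map D si (X a w0))).
have C'0 : 0 <= C' by exact: le_trans (hC (bds_map D ti (X a w0))).
pose K (p : {perm a}) := Ex (fun w =>
  g (bds_map D (inj_comp (@perm_inj _ p) si) (X a w)) * h (bds_map D ti (X a w))).
have bK (p : {perm a}) : bounded_measurable (fun w =>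
    g (bds_map D (inj_comp (@perm_inj _ p) si) (X a w)) * h (bds_map D ti (X a w))).
  by apply: bounded_measurableM; exact: bounded_measurable_X.
have bt : bounded_measurable (tensor g h) by exact: bounded_measurable_tensor.
have -> : Ex (fun w => perm_avg si g (X a w) * h (bds_map D ti (X a w))) = mean K.
  rewrite -(Rintegral_mean P bK); apply: eq_Rintegral => w _.
  by rewrite meanZr.
apply: (mean_perm_approx (s := s) (t := t)) => // p.
  rewrite (le_trans (ler_normB _ _))// (_ : 2 * C * C' = C * C' + C * C'); last by ring.
  apply: lerD; apply: Rintegral_norm_le => //.
  - by move=> w; rewrite normrM ler_pM.
  - exact: bounded_measurable_X.
  - by move=> w; rewrite normrM ler_pM.
move=> pst.
have pi : injective (sum_fun (p \o s) t).
  by apply: sum_fun_inj => //; exact: (inj_comp (@perm_inj _ p) si).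
rewrite (Rintegral_map ri pi bt); apply: eq_Rintegral => w _.
by rewrite (tensor_map _ _ (inj_comp (@perm_inj _ p) si) ti).
Qed.

(** * Second moments of averages *)

Section L2.
Context (C : R) (gC : forall y, `|g y| <= C).

(** With both sets equal, [Rintegral_perm_avgM] replaces one factor of the square by a single value
    of g; the collision estimate then separates the two copies of b. *)
Lemma Rintegral_perm_avg_sqr (a a' : {fset IDs}) (s : b -> a) (si : injective s)
    (r : b + b -> a') (ri : injective r) :
  (#|{: b + b}| <= #|{: a}|)%N -> (0 < #|{: a}|)%N ->
  `|Ex (fun w => perm_avg si g (X a w) ^+ 2) -
    Ex (fun w => tensor g g (bds_map D ri (X a' w)))| <=
  2 * C ^+ 2 * #|b|%:R ^+ 2 / #|{: a}|%:R.
Proof.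
move=> /inj_exists[r' ri'] a0.
have bt : bounded_measurable (tensor g g) by exact: bounded_measurable_tensor.
rewrite (Rintegral_map ri ri' bt).
under eq_Rintegral do rewrite expr2.
rewrite (Rintegral_perm_avgM si si) //.
rewrite (le_trans (Rintegral_perm_avg_approx si si ri' a0 bg gC gC))//.
by rewrite le_eqVlt; apply/orP; left; apply/eqP; ring.
Qed.

(** Pythagoras: the expected squared difference is the difference of the second moments. Both are
    close to the same expectation over two disjoint copies of b, and the two errors, each with
    factor 2, add up to 4. *)
Lemma Rintegral_perm_avg_cauchy (a c : {fset IDs}) (s : b -> a) (t : b -> c)
    (si : injective s) (ti : injective t) :
  (a `<=` c)%fset -> (#|{: b + b}| <= #|{: a}|)%N -> (0 < #|{: a}|)%N ->
  Ex (fun w => (perm_avg si g (X a w) - perm_avg ti g (X c w)) ^+ 2) <=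
  4 * C ^+ 2 * #|b|%:R ^+ 2 / #|{: a}|%:R.
Proof.
move=> ac bba a0.
have leac : (#|{: a}| <= #|{: c}|)%N by rewrite -!cardfE fsubset_leq_card.
have [r ri] := inj_exists bba.
have bA : bounded_measurable (fun w => perm_avg si g (X a w)).
  by apply: bounded_measurable_comp => //; exact: bounded_measurable_perm_avg.
have bB : bounded_measurable (fun w => perm_avg ti g (X c w)).
  by apply: bounded_measurable_comp => //; exact: bounded_measurable_perm_avg.
pose A := fun w => perm_avg si g (X a w); pose B := fun w => perm_avg ti g (X c w).
have bAA : bounded_measurable (fun w => A w * A w) by exact: bounded_measurableM.
have bBB : bounded_measurable (fun w => B w * B w) by exact: bounded_measurableM.
have bBA : bounded_measurable (fun w => B w * A w) by exact: bounded_measurableM.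
have E : Ex (fun w => (A w - B w) ^+ 2) =
    Ex (fun w => A w ^+ 2) - Ex (fun w => B w ^+ 2).
  transitivity (Ex (fun w => (A w * A w - B w * A w) + (B w * B w - B w * A w))).
    by apply: eq_Rintegral => w _; ring.
  rewrite RintegralD//; do ?by
    apply: bounded_measurable_integrable; exact: bounded_measurableB.
  rewrite !RintegralB//; do ?exact: bounded_measurable_integrable.
  rewrite (Rintegral_perm_avgM si ti ac) -(Rintegral_perm_avgM ti ti) // subrr addr0.
  by congr (_ - _); apply: eq_Rintegral => w _; rewrite expr2.
rewrite [leLHS]E.
have hA := Rintegral_perm_avg_sqr si ri bba a0.
have hB := Rintegral_perm_avg_sqr ti ri (leq_trans bba leac) (leq_trans a0 leac).
have hBA : 2 * C ^+ 2 * #|b|%:R ^+ 2 / #|{: c}|%:R <=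
    2 * C ^+ 2 * #|b|%:R ^+ 2 / #|{: a}|%:R.
  apply: ler_wpM2l.
    exact: mulr_ge0 (mulr_ge0 (ler0n _ 2) (sqr_ge0 _)) (sqr_ge0 _).
  have c0 := leq_trans a0 leac.
  by rewrite lef_pV2 ?ler_nat ?posrE ?ltr0n.
have hB' := le_trans hB hBA.
rewrite (_ : 4 * C ^+ 2 * #|b|%:R ^+ 2 / #|{: a}|%:R =
   2 * (2 * C ^+ 2 * #|b|%:R ^+ 2 / #|{: a}|%:R)); last by ring.
move: hA hB'; rewrite !ler_norml => /andP[_ hA] /andP[hB' _].
rewrite /A /B; lra.
Qed.

End L2.

End Averages.

End Exchangeability.

(** * Independence as factorization of expectations *)

Section Independence.
Context (R : realType) (d : measure_display) (D : BDS R d).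
Context d' (T : measurableType d') (P : probability T R).
Context (X : forall a : {fset IDs}, {RV P >-> D a}).
Hypothesis X_exch : exchangeable_measurement X.
Local Notation Ex f := (Rintegral P setT f).

(** The injections r, s and t are unrelated: for an exchangeable X the expectations do not depend on
    them, by [Rintegral_map], so each implication may choose convenient ones. *)
Definition multiplicative_expectations : Prop :=
  forall (b c : finType) (g : D b -> R) (h : D c -> R) (a : {fset IDs})
    (r : b + c -> a) (ri : injective r) (s : b -> a) (si : injective s)
    (t : c -> a) (ti : injective t),
    bounded_measurable g -> bounded_measurable h ->
    Ex (fun w => tensor g h (bds_map D ri (X a w))) =
    Ex (fun w => g (bds_map D si (X a w))) *
    Ex (fun w => h (bds_map D ti (X a w))).

Lemma independence_multiplicative :
  independence_property X -> multiplicative_expectations.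
Proof.
move=> Xind b c g h a r ri s si t ti bg bh.
pose rl := r \o inl; pose rr := r \o inr.
have rli : injective rl by exact: inj_comp ri (@inl_inj _ _).
have rri : injective rr by exact: inj_comp ri (@inr_inj _ _).
rewrite (Rintegral_map X_exch si rli bg) (Rintegral_map X_exch ti rri bh).
(* The two blocks of IDs occupied by r, disjoint since r is injective; the independence property is
   applied to them. *)
pose a1 := [fset x | x in codom (val \o rl)]%fset.
pose a2 := [fset x | x in codom (val \o rr)]%fset.
have a1P i : val (rl i) \in a1 by rewrite inE; apply/codomP; exists i.
have a2P i : val (rr i) \in a2 by rewrite inE; apply/codomP; exists i.
have sub1 : (a1 `<=` a)%fset.
  by apply/fsubsetP => x; rewrite inE /= => /codomP[i ->]; exact: valP.
have sub2 : (a2 `<=` a)%fset.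
  by apply/fsubsetP => x; rewrite inE /= => /codomP[i ->]; exact: valP.
have dis : [disjoint a1 & a2]%fset.
  apply/fdisjointP => x; rewrite !inE /= => /codomP[i ->].
  by apply/negP => /codomP[j /= /val_inj/ri].
pose s1 i : a1 := [` a1P i]%fset; pose s2 i : a2 := [` a2P i]%fset.
have s1i : injective s1 by move=> i j /(congr1 val)/= /val_inj/rli.
have s2i : injective s2 by move=> i j /(congr1 val)/= /val_inj/rri.
have e1 : rl =1 fincl sub1 \o s1 by move=> i; apply/val_inj.
have e2 : rr =1 fincl sub2 \o s2 by move=> i; apply/val_inj.
have ae1 := X_fincl_ae X_exch s1i rli e1.
have ae2 := X_fincl_ae X_exch s2i rri e2.
transitivity (Ex (fun w => g (bds_map D s1i (X a1 w)) * h (bds_map D s2i (X a2 w)))).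
  apply: ae_eq_Rintegral.
  - by apply: (bounded_measurable_X X); exact: bounded_measurable_tensor.
  - by apply: bounded_measurableM; exact: (bounded_measurable_X X).
  apply: filterS2 ae1 ae2 => w w1 w2; rewrite (tensor_map _ _ rli rri) ?w1 ?w2//.
  by case.
have bg1 : bounded_measurable (g \o bds_map D s1i).
  exact: bounded_measurable_comp (bds_measurable _) bg.
have bh2 : bounded_measurable (h \o bds_map D s2i).
  exact: bounded_measurable_comp (bds_measurable _) bh.
rewrite (Rintegral_independent (Xind _ _ dis) bg1 bh2); congr (_ * _).
  exact: (Rintegral_map X_exch).
exact: (Rintegral_map X_exch).
Qed.

Lemma multiplicative_independence :
  multiplicative_expectations -> independence_property X.
Proof.
move=> Xm a b ab A B mA mB.
have ac : (a `<=` a `|` b)%fset by exact: fsubsetUl.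
have bc : (b `<=` a `|` b)%fset by exact: fsubsetUr.
pose ai := @fincl_inj _ _ _ ac; pose bi := @fincl_inj _ _ _ bc.
have ri : injective (sum_fun (fincl ac) (fincl bc)).
  apply: sum_fun_inj => // i j /(congr1 val) /= ij.
  by move/fdisjointP : ab => /(_ _ (valP i))/negP; apply;
    rewrite [X in X \in _]ij; exact: valP.
have bA := bounded_measurable_indic R mA; have bB := bounded_measurable_indic R mB.
have := Xm _ _ _ _ _ _ ri _ ai _ bi bA bB.
have mXA : measurable (X a @^-1` A).
  by rewrite -[X in measurable X]setTI; exact: measurable_funPT.
have mXB : measurable (X b @^-1` B).
  by rewrite -[X in measurable X]setTI; exact: measurable_funPT.
rewrite (Rintegral_map X_exch ai (@inj_id a) bA)
  (Rintegral_map X_exch bi (@inj_id b) bB).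
have -> : Ex (fun w => \1_A (bds_map D (@inj_id a) (X a w))) = fine (P (X a @^-1` A)).
  by rewrite -Rintegral_indicT//; apply: eq_Rintegral => w _; rewrite bds_map_id.
have -> : Ex (fun w => \1_B (bds_map D (@inj_id b) (X b w))) = fine (P (X b @^-1` B)).
  by rewrite -Rintegral_indicT//; apply: eq_Rintegral => w _; rewrite bds_map_id.
have -> : Ex (fun w => tensor \1_A \1_B (bds_map D ri (X (a `|` b)%fset w))) =
    fine (P (X a @^-1` A `&` X b @^-1` B)).
  rewrite -Rintegral_indicT//; last exact: measurableI.
  apply: ae_eq_Rintegral.
  - by apply: (bounded_measurable_X X); exact: bounded_measurable_tensor.
  - by apply: bounded_measurable_indic; exact: measurableI.
  have [Xr _] := X_exch; apply: filterS2 (Xr _ _ ac) (Xr _ _ bc) => w w1 w2.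
  by rewrite (tensor_map _ _ ai bi)// [bds_map D ai _]w1 [bds_map D bi _]w2 indicI.
move=> e; rewrite -[LHS]fineK ?fin_num_measure//; last exact: measurableI.
by rewrite e EFinM !fineK ?fin_num_measure.
Qed.

End Independence.

(** * Deterministic approximation *)

Section Approximation.
Context (R : realType) (d : measure_display) (D : BDS R d).
Context d' (T : measurableType d') (P : probability T R).
Context (X : forall a : {fset IDs}, {RV P >-> D a}).
Hypothesis X_exch : exchangeable_measurement X.
Local Notation Ex f := (Rintegral P setT f).

Lemma perm_avg_precomp (c b a : finType) (s : b -> a) (t : c -> b)
    (si : injective s) (ti : injective t) (g : D c -> R) (x : D a) :
  perm_avg si (fun y => g (bds_map D ti y)) x = perm_avg (inj_comp si ti) g x.
Proof. by apply: eq_mean => p; congr g; apply: bds_map_trans. Qed.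

Lemma initseg_fincl_inj (m n : nat) (mn : (m <= n)%N) :
  injective (fincl (initseg_sub mn)).
Proof. exact: fincl_inj. Qed.

Lemma avg_precomp (c : finType) (k n : nat) (kn : (k <= n)%N)
    (t : c -> initseg k) (ti : injective t) (g : D c -> R) (x : D (initseg n)) :
  avg (fun y : D (initseg k) => g (bds_map D ti y)) x =
  perm_avg (inj_comp (@initseg_fincl_inj _ _ kn) ti) g x.
Proof. by rewrite (avgE (@initseg_fincl_inj _ _ kn)) perm_avg_precomp. Qed.

Lemma approximation_multiplicative :
  deterministic_approximation X -> multiplicative_expectations X.
Proof.
move=> Xapp b c g h a r ri s si t ti bg bh.
(* The hypothesis only concerns functions on initial segments. So g, h and their tensor are
   transported to one [k] with k = #|b + c|, and these three functions form the countable set. *)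
have [u0 u0i] : exists u : b + c -> initseg #|{: b + c}|, injective u.
  by apply: inj_exists; rewrite card_initseg.
pose k := #|{: b + c}|.
pose u : b + c -> initseg k := u0; pose ui : injective u := u0i.
pose ul := u \o inl; pose ur := u \o inr.
have uli : injective ul by exact: inj_comp ui (@inl_inj _ _).
have uri : injective ur by exact: inj_comp ui (@inr_inj _ _).
have bt := bounded_measurable_tensor bg bh.
pose g1 (y : D (initseg k)) := g (bds_map D uli y).
pose h1 (y : D (initseg k)) := h (bds_map D uri y).
pose gh1 (y : D (initseg k)) := tensor g h (bds_map D ui y).
pose mk (f : D (initseg k) -> R) : {k : nat & D (initseg k) -> R} := existT _ k f.
have bmap (e : finType) (v : e -> initseg k) (vi : injective v) (f : D e -> R) :
    bounded_measurable f -> bounded_measurable (fun y => f (bds_map D vi y)).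
  exact: bounded_measurable_comp (bds_measurable _).
have [||m [x [moo lim]]] := Xapp [set mk g1; mk h1; mk gh1].
- by apply: finite_set_countable; rewrite !finite_setU; do ?split; exact: finite_set1.
- move=> j f fG; suff /(_ _ fG) : forall z, [set mk g1; mk h1; mk gh1] z ->
      bounded_measurable (projT2 z) by [].
  by move=> z [[->|->]|->]; exact: bmap.
have limE (f : D (initseg k) -> R) : bounded_measurable f ->
    [set mk g1; mk h1; mk gh1] (mk f) ->
    avg f (x n) @[n --> \oo] --> Ex (fun w => f (X (initseg k) w)).
  move=> bf /lim; rewrite expectation_Rintegral; last first.
    exact: bounded_measurable_comp.
  by move=> /fine_cvg; apply: cvg_trans; apply: near_eq_cvg; near=> n.
have limg := limE g1 (bmap _ _ uli _ bg) (or_introl (or_introl erefl)).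
have limh := limE h1 (bmap _ _ uri _ bh) (or_introl (or_intror erefl)).
have limgh := limE gh1 (bmap _ _ ui _ bt) (or_intror erefl).
have -> : Ex (fun w => g (bds_map D si (X a w))) = Ex (fun w => g1 (X (initseg k) w)).
  exact: (Rintegral_map X_exch).
have -> : Ex (fun w => h (bds_map D ti (X a w))) = Ex (fun w => h1 (X (initseg k) w)).
  exact: (Rintegral_map X_exch).
have -> : Ex (fun w => tensor g h (bds_map D ri (X a w))) =
    Ex (fun w => gh1 (X (initseg k) w)).
  exact: (Rintegral_map X_exch).
apply/esym/eqP; rewrite -subr_eq0; apply/eqP.
have diff : avg g1 (x n) * avg h1 (x n) - avg gh1 (x n) @[n --> \oo] -->
    Ex (fun w => g1 (X (initseg k) w)) * Ex (fun w => h1 (X (initseg k) w)) -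
    Ex (fun w => gh1 (X (initseg k) w)).
  by apply: cvgB limgh; exact: cvgM.
(* The same sequence tends to 0, by [perm_avg_mul_approx] and because m_n tends to infinity. *)
rewrite -(cvg_lim (@Rhausdorff R) diff); apply: cvg_lim => //.
have [[_ [C gC]] [_ [C' hC]]] := (bg, bh).
pose K := (2 * C * C') * #|b|%:R * #|c|%:R.
have m0 : (m n)%:R^-1 @[n --> \oo] --> (0 : R).
  apply/gtr0_cvgV0; last exact/cvgrnyP.
  by near=> n; rewrite ltr0n; near: n; move/cvgnyPge : moo => /(_ 1%N).
have Km0 : K * (m n)%:R^-1 @[n --> \oo] --> (0 : R).
  by rewrite -[X in _ --> X](mulr0 K); apply: cvgMr.
apply: norm_cvg0; apply: (squeeze_cvgr _ (cvg_cst 0) Km0).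
near=> n.
have kn : (k <= m n)%N by near: n; move/cvgnyPge : moo => /(_ k).
have n0 : (1 <= m n)%N by near: n; move/cvgnyPge : moo => /(_ 1%N).
rewrite normr_ge0 /=.
have e1 : injective
    (sum_fun (fincl (initseg_sub kn) \o ul) (fincl (initseg_sub kn) \o ur)).
  apply: (eq_inj (inj_comp (@initseg_fincl_inj _ _ kn) ui)).
  by case.
have := @perm_avg_mul_approx _ _ D _ _ _ _ _ (inj_comp (@initseg_fincl_inj _ _ kn) uli)
  (inj_comp (@initseg_fincl_inj _ _ kn) uri) e1 g h C C' (x n).
rewrite card_initseg => /(_ n0 gC hC); apply: le_trans.
rewrite /g1 /h1 /gh1 !(avg_precomp kn).
rewrite le_eqVlt; apply/orP; left; apply/eqP; congr (`| _ - _ |).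
by apply: eq_mean => p; congr (tensor g h _); apply: bds_map_ext; case.
Unshelve. all: by end_near.
Qed.

(** Factorization identifies the limiting second moment of [Rintegral_perm_avg_sqr] with the square
    of the mean. *)
Lemma perm_avg_variance : multiplicative_expectations X ->
  forall (b : finType) (g : D b -> R) (C : R) (a a' : {fset IDs}) (s : b -> a)
    (si : injective s) (t : b -> a') (ti : injective t),
  bounded_measurable g -> (forall y, `|g y| <= C) ->
  (#|{: b + b}| <= #|{: a}|)%N -> (0 < #|{: a}|)%N ->
  Ex (fun w => (perm_avg si g (X a w) - Ex (fun w => g (bds_map D ti (X a' w)))) ^+ 2)
  <= 2 * C ^+ 2 * #|b|%:R ^+ 2 / #|{: a}|%:R.
Proof.
move=> Xm b g C a a' s si t ti bg gC bba a0.
have [r ri] := inj_exists bba.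
pose A w := perm_avg si g (X a w).
have bA : bounded_measurable A.
  by apply: bounded_measurable_comp => //; exact: bounded_measurable_perm_avg.
pose mu := Ex (fun w => g (bds_map D ti (X a' w))).
have EA : Ex A = mu by exact: (Rintegral_perm_avg X_exch bg si ti).
have bA2 : bounded_measurable (fun w => A w ^+ 2) by exact: bounded_measurableM.
have E : Ex (fun w => (A w - mu) ^+ 2) = Ex (fun w => A w ^+ 2) - mu * mu.
  transitivity (Ex (fun w => A w ^+ 2 - ((2 * mu) * A w - mu * mu))).
    by apply: eq_Rintegral => w _; ring.
  have bc := bounded_measurable_cst T (mu * mu).
  have bmA : bounded_measurable (fun w => (2 * mu) * A w).
    by apply: bounded_measurableM => //; exact: bounded_measurable_cst.
  have bd : bounded_measurable (fun w => (2 * mu) * A w - mu * mu).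
    exact: bounded_measurableB.
  have I f : bounded_measurable f -> P.-integrable setT (EFin \o f).
    exact: bounded_measurable_integrable.
  rewrite (RintegralB _ (I _ bA2) (I _ bd))//.
  rewrite (RintegralB _ (I _ bmA) (I _ bc))//.
  by rewrite (RintegralZl _ _ (I _ bA))// Rintegral_cstT EA; ring.
rewrite [leLHS]E (le_trans (ler_norm _))//.
have -> : mu * mu = Ex (fun w => tensor g g (bds_map D ri (X a w))).
  have ris : injective (fun i => r (inl i)) by exact: inj_comp ri (@inl_inj _ _).
  by rewrite (Xm _ _ _ _ _ _ ri _ ris _ ris bg bg) -(Rintegral_map X_exch ti ris bg).
exact: (Rintegral_perm_avg_sqr X_exch).
Qed.

(** A diagonal argument: at stage N the first N squared deviations together have small expectation
    for large m, so some sample point makes them small at once; the data there are the sought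
    x_N. *)
Lemma multiplicative_approximation :
  multiplicative_expectations X -> deterministic_approximation X.
Proof.
move=> Xm G /countable_injP[f finj] Gb.
(* A partial inverse of the injection f: an enumeration of G with gaps, which will contribute the
   deviation 0. *)
pose e (i : nat) : option {k : nat & D (initseg k) -> R} :=
  match pselect (exists2 z, G z & f z = i) with
  | left h => Some (projT1 (cid2 h)) | right _ => None end.
have eG i z : e i = Some z -> G z.
  by rewrite /e; case: pselect => // h [<-]; case: (cid2 h).
have eS z : G z -> e (f z) = Some z.
  move=> Gz; rewrite /e; case: pselect => [h|]; last by case; exists z.
  congr Some; case: (cid2 h) => z' Gz' fz' /=.
  by apply: finj => //; exact/mem_set.
pose mu (z : {k : nat & D (initseg k) -> R}) :=
  Ex (fun w => projT2 z (X (initseg (projT1 z)) w)).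
pose dev (i m : nat) (w : T) : R :=
  if e i is Some z then (avg (projT2 z) (X (initseg m) w) - mu z) ^+ 2 else 0.
have devP i : exists K M, forall m, (M <= m)%N ->
    bounded_measurable (dev i m) /\ Ex (dev i m) <= K / m%:R.
  rewrite /dev; case ei : (e i) => [[k g]|]; last first.
    exists 0, 0%N => m _; split; first exact: bounded_measurable_cst.
    by rewrite Rintegral_cstT mul0r.
  have bg : bounded_measurable g by exact/Gb/eG/ei.
  have [_ [C gC]] := bg.
  (* The threshold makes m positive and leaves room for two disjoint copies of [k] in [m], as the
     variance bound requires; for m < k, [avg] would be an empty sum. *)
  exists (2 * C ^+ 2 * k%:R ^+ 2), (k + k).+1 => m km /=.
  have km' : (k <= m)%N by rewrite (leq_trans _ (ltnW km))// leq_addr.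
  have E w : avg g (X (initseg m) w) =
      perm_avg (@initseg_fincl_inj _ _ km') g (X (initseg m) w) by exact: avgE.
  under eq_fun do rewrite E.
  split.
    have ? : bounded_measurable (fun w =>
        perm_avg (@initseg_fincl_inj _ _ km') g (X (initseg m) w) - mu (existT _ k g)).
      apply: bounded_measurableB; last exact: bounded_measurable_cst.
      by apply: bounded_measurable_comp => //; exact: bounded_measurable_perm_avg.
    exact: bounded_measurableM.
  have -> : mu (existT _ k g) =
      Ex (fun w => g (bds_map D (@inj_id (initseg k)) (X (initseg k) w))).
    by apply: eq_Rintegral => w _; rewrite bds_map_id.
  have := @perm_avg_variance Xm _ _ C _ _ _ (@initseg_fincl_inj _ _ km') _
    (@inj_id (initseg k)) bg gC.
  rewrite card_sum !card_initseg; apply; first exact: ltnW.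
  exact: leq_trans km.
have sdevP N : exists K M, forall m, (M <= m)%N ->
    bounded_measurable (fun w => \sum_(i < N) dev i m w) /\
    Ex (fun w => \sum_(i < N) dev i m w) <= K / m%:R.
  elim: N => [|N [K [M IH]]].
    exists 0, 0%N => m _; under eq_fun do rewrite big_ord0.
    by split; [exact: bounded_measurable_cst|rewrite Rintegral_cstT mul0r].
  have [K' [M' H]] := devP N.
  exists (K + K'), (maxn M M') => m; rewrite geq_max => /andP[/IH[bS lS] /H[bd ld]].
  under eq_fun do rewrite big_ord_recr/=.
  split; first exact: bounded_measurableD.
  rewrite RintegralD//; do ?exact: bounded_measurable_integrable.
  by rewrite mulrDl lerD.
(* The bound is a square so that each single deviation is below 1/(N+1) in absolute value. *)
have pick N : exists mw : nat * T, (N <= mw.1)%N /\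
    \sum_(i < N) dev i mw.1 mw.2 < (N.+1%:R^-1) ^+ 2.
  have [K [M H]] := sdevP N.
  have e0 : 0 < (N.+1%:R^-1 : R) ^+ 2 by rewrite exprn_gt0// invr_gt0 ltr0n.
  have [m0 Hm0] : exists m0 : nat, `|K| / (N.+1%:R^-1) ^+ 2 < m0%:R.
    exists (Num.bound (`|K| / (N.+1%:R^-1) ^+ 2)).
    by rewrite archi_boundP// divr_ge0// ltW.
  (* Past m0 the expectation drops below the threshold, past M the bound is valid, and m >= N forces
     the sizes to infinity. *)
  pose m := maxn m0.+1 (maxn M N).
  have mm0 : (m0 < m)%N by rewrite leq_max leqnn.
  have [bS lS] := H m (leq_trans (leq_maxl M N) (leq_maxr _ _)).
  have [|w hw] := @Rintegral_lt_exists _ _ _ P _ ((N.+1%:R^-1) ^+ 2) bS.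
    apply: le_lt_trans lS _.
    have m_gt0 : 0 < m%:R :> R by rewrite ltr0n (leq_ltn_trans _ mm0).
    rewrite ltr_pdivrMr// mulrC -ltr_pdivrMr//.
    apply: le_lt_trans (lt_trans Hm0 _); last by rewrite ltr_nat.
    by rewrite ler_pM2r ?invr_gt0// ler_norm.
  by exists (m, w); split => //=; rewrite !leq_max leqnn !orbT.
pose mw N := projT1 (cid (pick N)).
have mwP N : (N <= (mw N).1)%N /\
    \sum_(i < N) dev i (mw N).1 (mw N).2 < (N.+1%:R^-1) ^+ 2.
  exact: projT2 (cid (pick N)).
exists (fun N => (mw N).1), (fun N => X (initseg (mw N).1) (mw N).2); split.
  apply/cvgnyPge => A; near=> N; apply: leq_trans (mwP N).1.
  by near: N; exact: nbhs_infty_ge.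
move=> k g Gg; have bg : bounded_measurable g by exact: Gb.
rewrite expectation_Rintegral; last exact: bounded_measurable_comp.
apply/fine_cvgP; split; first by near=> N.
rewrite -[Rintegral _ _ _]/(mu (existT _ k g)).
apply/cvgrPdist_le => eps eps0; near=> N.
have fN : (f (existT _ k g) < N)%N by near: N; exact: nbhs_infty_gt.
have := (mwP N).2; rewrite (bigD1 (Ordinal fN))//= {1}/dev eS//= => devN.
have {}devN : (avg g (X (initseg (mw N).1) (mw N).2) - mu (existT _ k g)) ^+ 2 <
    (N.+1%:R^-1) ^+ 2.
  apply: le_lt_trans devN; rewrite lerDl sumr_ge0// => i _.
  by rewrite /dev; case: (e i) => // z; exact: sqr_ge0.
rewrite distrC; apply: (@le_trans _ _ N.+1%:R^-1).
  rewrite -[leRHS]ger0_norm ?invr_ge0// -ler_sqr ?nnegrE//; last first.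
  by rewrite -!normrX !ger0_norm ?sqr_ge0// ltW.
near: N; apply: filterS (near_infty_natSinv_lt (PosNum eps0)) => N; exact: ltW.
Unshelve. all: by end_near.
Qed.

End Approximation.

(** * The projective limit *)

Section FiniteMeasureUnique.
Context d (T : measurableType d) (R : realType).

(** Written for generators that need not contain the whole space, such as the cylinders, which lie
    in the limit: equality of total masses is assumed separately and [setT] is adjoined. *)
Lemma finite_measure_unique (G : set (set T)) (m1 m2 : {measure set T -> \bar R}) :
  @measurable _ T = <<s G>> -> setI_closed G ->
  m1 setT = m2 setT -> (m1 setT < +oo)%E ->
  (forall A, G A -> m1 A = m2 A) ->
  forall A, measurable A -> m1 A = m2 A.
Proof.
move=> mG GI mT moo mm A mA.
apply: (measure_unique (G `|` [set setT]) (fun=> setT)) => //.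
- apply/seteqP; split.
    by rewrite mG; apply: sub_sigma_algebra2; exact: subsetUl.
  apply: smallest_sub; first exact: sigma_algebra_measurable.
  by move=> B [GB|->//]; rewrite mG; exact: sub_sigma_algebra.
- move=> B C [GB|->]; last by rewrite setTI.
  by move=> [GC|->]; [left; exact: GI|rewrite setIT; left].
- by move=> i; right.
- by rewrite bigcup_const.
by move=> B [/mm|->].
Qed.

End FiniteMeasureUnique.

Section ProjectiveLimit.
Context (R : realType) (d : measure_display) (D : BDS R d).

(* Only inside the limit are the cylinders stable under intersection: there,
   conditions on x_a and x_b are conditions on x_(a `|` b). *)
Definition bds_cylinders : set (set (bds_prod D)) :=
  \bigcup_(a in [set: {fset IDs}])
    preimage_set_system (@bds_lim R d D) (fun x : bds_prod D => x a) measurable.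

Local Notation lim := (@bds_lim R d D).
(** A sigma-algebra on the whole product, generated by subsets of the limit: this provides a
    measurable type whose trace on the limit is [bds_lim_measurable]. Coordinates are accordingly
    shown measurable on [lim] only. *)
Local Notation prodT := (g_sigma_algebraType bds_cylinders).

Lemma bds_cylindersI : setI_closed bds_cylinders.
Proof.
move=> _ _ [a _ [A mA <-]] [b _ [B mB <-]].
have ac : (a `<=` a `|` b)%fset by exact: fsubsetUl.
have bc : (b `<=` a `|` b)%fset by exact: fsubsetUr.
exists (a `|` b)%fset => //.
exists (bds_restr ac @^-1` A `&` bds_restr bc @^-1` B).
  by apply: measurableI; rewrite -[X in measurable X]setTI; exact: bds_measurable.
apply/seteqP; split => [x [Lx] [/=]|x [[Lx /= xA] [_ /= xB]]].
  by rewrite (Lx _ _ ac) (Lx _ _ bc) => xA xB; split; split.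
by split => //; split; rewrite /= ?(Lx _ _ ac) ?(Lx _ _ bc).
Qed.

Lemma bds_cylinderT : bds_cylinders lim.
Proof. by exists fset0 => //; exists setT => //; rewrite preimage_setT setIT. Qed.

Lemma measurable_bds_lim : measurable (lim : set prodT).
Proof. exact: sub_sigma_algebra bds_cylinderT. Qed.

Lemma measurable_fun_coord (a : {fset IDs}) :
  measurable_fun (lim : set prodT) (fun x : prodT => x a).
Proof. by move=> _ A mA; apply: sub_sigma_algebra; exists a => //; exists A. Qed.

Lemma bds_lim_measurable_measurable (M : set (bds_prod D)) :
  bds_lim_measurable M -> measurable (M : set prodT).
Proof.
apply: smallest_sub; last by move=> A; exact: sub_sigma_algebra.
split; first exact: measurable0.
- by move=> A mA; apply: measurableD => //; exact: measurable_bds_lim.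
- by move=> F mF; exact: bigcupT_measurable.
Qed.

Lemma measurable_bds_lim_measurable (M : set (bds_prod D)) :
  measurable (M : set prodT) -> bds_lim_measurable (lim `&` M).
Proof.
move: M; apply: smallest_sub => /=.
  split => /=.
  - by rewrite setI0; exact: sigma_algebra0.
  - move=> A mA; rewrite setTD (_ : _ `&` _ = lim `\` (lim `&` A)).
      exact: sigma_algebraCD.
    by rewrite setDIr setDv set0U setDE.
  - by move=> F mF; rewrite setI_bigcupr; exact: sigma_algebra_bigcup.
move=> _ [a _ [A mA <-]] /=; rewrite setIA setIid.
by apply: sub_sigma_algebra; exists a => //; exists A.
Qed.

Lemma bds_lim_measurable_sub (M : set (bds_prod D)) :
  bds_lim_measurable M -> M `<=` lim.
Proof.
move: M; apply: smallest_sub => /=.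
  split; first exact: sub0set.
  - by move=> A _ x [].
  - by move=> F FL x [n _ /FL].
by move=> _ [a _ [A mA <-]] x [].
Qed.

(** * The action of bijections of the IDs on the limit *)

Section Action.
Implicit Types (p q : IDs -> IDs).

(** At a compatible x the action can be read off at any set c containing the image of b, which
    avoids transport along equalities of image sets. *)
Lemma bds_actE p (pb : bijective p) (x : bds_prod D) (b c : {fset IDs})
    (k : b -> c) (ki : injective k) :
  lim x -> (forall i, val (k i) = p (val i)) ->
  bds_act pb x b = bds_map D ki (x c).
Proof.
move=> Lx kp.
have sub : ([fset p i | i in b] `<=` c)%fset.
  by apply/fsubsetP => _ /imfsetP[i /= ib ->]; rewrite -(kp [` ib]%fset) (valP (k _)).
rewrite /bds_act -(Lx _ _ sub) /bds_restr; apply: bds_map_trans => i.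
exact/val_inj/kp.
Qed.

Lemma bds_act_lim p (pb : bijective p) (x : bds_prod D) :
  lim x -> lim (bds_act pb x).
Proof.
move=> Lx a' a sub.
pose c := [fset p i | i in a]%fset.
have ki : injective (@restr_img p a) by exact: restr_img_inj (bij_inj pb).
have ki' : injective (@restr_img p a \o fincl sub).
  exact: inj_comp ki (@fincl_inj _ _ _ sub).
rewrite (@bds_actE p pb x a c _ ki Lx) //.
rewrite (@bds_actE p pb x a' c _ ki' Lx) //.
exact: bds_map_trans.
Qed.

Lemma bds_act_comp p q (pb : bijective p) (qb : bijective q) (x : bds_prod D) :
  lim x -> cancel p q -> bds_act pb (bds_act qb x) = x.
Proof.
move=> Lx pq; apply: functional_extensionality_dep => b.
pose c := [fset p i | i in b]%fset.
have ki : injective (@restr_img p b) by exact: restr_img_inj (bij_inj pb).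
rewrite (@bds_actE p pb _ b c _ ki (bds_act_lim qb Lx)) //.
have H (i : c) : q (val i) \in b.
  by case: i => _ /= /imfsetP[j /= jb ->]; rewrite pq.
pose k i := [` H i]%fset.
have ki' : injective k.
  by move=> i j /(congr1 val)/= /(bij_inj qb)/val_inj.
rewrite (@bds_actE q qb x c b k ki' Lx) // -bds_map_comp.
by apply: bds_map_id1 => i; apply/val_inj; rewrite /= pq.
Qed.

Lemma finite_support_inv p q : cancel p q -> cancel q p ->
  finite_set [set i | p i <> i] -> finite_set [set i | q i <> i].
Proof.
move=> pq qp; apply: sub_finite_set => i /= qi pi; apply: qi.
by rewrite -{1}pi pq.
Qed.

Lemma bds_invariant_act (M : set (bds_prod D)) p (pb : bijective p) x :
  bds_invariant M -> finite_set [set i | p i <> i] -> lim x ->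
  M (bds_act pb x) <-> M x.
Proof.
move=> [mM MI] pfin Lx; split => Mx; last by rewrite -(MI _ pb pfin); exists x.
have [q pq qp] := pb; have qb : bijective q by exists p.
rewrite -(bds_act_comp qb pb Lx qp) -(MI _ qb (finite_support_inv pq qp pfin)).
by exists (bds_act pb x).
Qed.

(** Closure under the action suffices because the inverse of a finitary bijection is finitary. *)
Lemma bds_invariantI (M : set (bds_prod D)) : bds_lim_measurable M ->
  (forall p (pb : bijective p) x, finite_set [set i | p i <> i] -> M x ->
    M (bds_act pb x)) ->
  bds_invariant M.
Proof.
move=> mM MI; split => // p pb pfin; apply/seteqP; split.
  by move=> _ [x Mx <-]; exact: MI.
have [q pq qp] := pb; have qb : bijective q by exists p.
move=> x Mx; exists (bds_act qb x).
  by apply: MI => //; exact: finite_support_inv pfin.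
by apply: bds_act_comp => //; exact: bds_lim_measurable_sub Mx.
Qed.

End Action.

(** Here the Borel hypothesis enters: a measurable injection into the reals reduces equality in
    [D a] to equality of two real functions. *)
Lemma measurable_bds_eq d1 (S : measurableType d1) (a : finType) (Y Z : S -> D a) :
  measurable_fun setT Y -> measurable_fun setT Z ->
  measurable [set w | Y w = Z w].
Proof.
move=> mY mZ; have [B [f [_ _ [_ finj _] mf _]]] := bds_Borel D a.
have := measurable_fun_eqr (measurableT_comp mf mY) (measurableT_comp mf mZ).
move=> /(_ measurableT [set true] I); rewrite setTI.
congr measurable; apply/seteqP; split => w /=; last by move=> ->; rewrite eqxx.
by move=> /eqP; apply: finj; rewrite inE.
Qed.

(** Compatibility is a countable conjunction of equalities, one for each pair of finite ID sets. *)
Lemma measurable_in_bds_lim d1 (S : measurableType d1)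
    (Z : forall a : {fset IDs}, S -> D a) :
  (forall a, measurable_fun setT (Z a)) ->
  measurable [set w | lim (fun a => Z a w)].
Proof.
move=> mZ.
pose E (aa : {fset IDs} * {fset IDs}) : set S :=
  [set w | forall sub : (aa.1 `<=` aa.2)%fset, bds_restr sub (Z aa.2 w) = Z aa.1 w].
rewrite (_ : mkset _ = ~` (\bigcup_aa ~` E aa)); last first.
  rewrite setC_bigcup; apply/seteqP; split => w.
    by move=> H [a' a] _ ; rewrite setCK => sub; exact: H.
  by move=> H a' a sub; have := H (a', a) I; rewrite setCK; exact.
apply: measurableC; apply: countable_bigcupT_measurable; first exact: countableP.
move=> -[a' a].
apply: measurableC; rewrite /E /=.
have [sub|nsub] := pselect (a' `<=` a)%fset; last first.
  rewrite (_ : mkset _ = setT); first exact: measurableT.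
  by apply/seteqP; split => // w _ sub.
rewrite (_ : mkset _ = [set w | bds_restr sub (Z a w) = Z a' w]).
  apply: measurable_bds_eq => //.
  by apply: measurableT_comp => //; exact: bds_measurable.
apply/seteqP; split => w /= H; first exact: H.
by move=> sub'; rewrite (bool_irrelevance sub' sub).
Qed.

Lemma measurable_random_point d1 (S : measurableType d1)
    (Z : forall a : {fset IDs}, S -> D a) :
  (forall a, measurable_fun setT (Z a)) ->
  measurable_fun setT (fun w => (fun a => Z a w) : prodT).
Proof.
move=> mZ; apply: (@measurability _ _ S prodT setT _ bds_cylinders erefl).
move=> _ [_ [a _ [A mA <-]] <-]; rewrite setTI preimage_setI.
apply: measurableI; first exact: measurable_in_bds_lim.
by rewrite -[X in measurable X]setTI; exact: mZ.
Qed.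

End ProjectiveLimit.

(** * Invariant events under factorization *)

Lemma le0_of_le_inv_nat (R : realType) (x K : R) (N : nat) :
  (forall n, (N < n)%N -> x <= K / n%:R) -> x <= 0.
Proof.
move=> H; rewrite leNgt; apply/negP => x0.
have [m Hm] : exists m : nat, `|K| / x < m%:R.
  by exists (Num.bound (`|K| / x)); rewrite archi_boundP// divr_ge0// ltW.
pose n := (maxn m N).+1.
have n0 : 0 < n%:R :> R by rewrite ltr0n.
have := H n; rewrite ltnS leq_maxr => /(_ isT).
rewrite ler_pdivlMr// leNgt => /negP; apply.
apply: le_lt_trans (ler_norm K) _; rewrite mulrC -ltr_pdivrMr//.
by apply: lt_le_trans Hm _; rewrite ler_nat ltnW// ltnS leq_maxl.
Qed.

Lemma sqr_Rintegral_le d (T : measurableType d) (R : realType)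
    (P : probability T R) (f : T -> R) : bounded_measurable f ->
  Rintegral P setT f ^+ 2 <= Rintegral P setT (fun w => f w ^+ 2).
Proof.
move=> bf; set m := Rintegral P setT f.
have bf2 : bounded_measurable (fun w => f w ^+ 2) by exact: bounded_measurableM.
have bmf : bounded_measurable (fun w => (2 * m) * f w).
  by apply: bounded_measurableM => //; exact: bounded_measurable_cst.
have bc := bounded_measurable_cst T (m * m).
have bd : bounded_measurable (fun w => (2 * m) * f w - m * m).
  exact: bounded_measurableB.
have : 0 <= Rintegral P setT (fun w => f w ^+ 2 - ((2 * m) * f w - m * m)).
  apply: Rintegral_ge0 => w _; rewrite (_ : _ - _ = (f w - m) ^+ 2) ?sqr_ge0//.
  by ring.
have I h : bounded_measurable h -> P.-integrable setT (EFin \o h).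
  exact: bounded_measurable_integrable.
rewrite (RintegralB _ (I _ bf2) (I _ bd))// (RintegralB _ (I _ bmf) (I _ bc))//.
rewrite (RintegralZl _ _ (I _ bf))// Rintegral_cstT -/m; lra.
Qed.

(** * Permutations of [n] as finitary bijections of all IDs *)

Section PermExtension.

Definition perm_extend (n : nat) (k : {perm initseg n}) (i : IDs) : IDs :=
  if insub i is Some j then val (k j) else i.

Lemma perm_extend_val n (k : {perm initseg n}) (j : initseg n) :
  perm_extend k (val j) = val (k j).
Proof. by rewrite /perm_extend valK. Qed.

Lemma perm_extendK n (k : {perm initseg n}) :
  cancel (perm_extend k) (perm_extend k^-1)%g.
Proof.
move=> i; case: (boolP (i \in initseg n)) => [ii|/negbTE ni].
  by rewrite (perm_extend_val k [` ii]%fset) perm_extend_val permK.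
by rewrite /perm_extend !insubN ?ni.
Qed.

Lemma perm_extend_bij n (k : {perm initseg n}) : bijective (perm_extend k).
Proof.
exists (perm_extend k^-1)%g; first exact: perm_extendK.
by rewrite -{2}[k]invgK; exact: perm_extendK.
Qed.

Lemma perm_extend_finite n (k : {perm initseg n}) :
  finite_set [set i | perm_extend k i <> i].
Proof.
apply: (sub_finite_set (B := [set` initseg n])) (finite_fset _) => i /= ki.
by apply/negPn/negP => /negbTE ni; apply: ki; rewrite /perm_extend insubN ?ni.
Qed.

End PermExtension.

Section Ergodicity.
Context (R : realType) (d : measure_display) (D : BDS R d).
Context d' (T : measurableType d') (P : probability T R).
Context (X : forall a : {fset IDs}, {RV P >-> D a}).
Hypothesis X_exch : exchangeable_measurement X.
Local Notation Ex f := (Rintegral P setT f).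
Local Notation lim := (@bds_lim R d D).
Local Notation prodT := (g_sigma_algebraType (@bds_cylinders R d D)).

Definition random_point (w : T) : prodT := fun a => X a w.

Lemma measurable_random_point_X : measurable_fun setT random_point.
Proof.
have H : forall a, measurable_fun setT (fun w => X a w).
  by move=> a; exact: measurable_funPT.
exact: (measurable_random_point H).
Qed.

Lemma random_point_lim : {ae P, forall w, lim (random_point w)}.
Proof.
have [Xr _] := X_exch.
(* Pairs of finite ID sets are enumerated through their codes; a number coding no pair imposes no
   condition. *)
have H n : {ae P, forall w,
    if @choice.unpickle ({fset IDs} * {fset IDs})%type n is Some (a', a) then
    forall sub : (a' `<=` a)%fset, bds_restr sub (X a w) = X a' w else True}.
  case: (choice.unpickle n) => [[a' a]|]; last exact: aeW.
  have [sub|nsub] := pselect (a' `<=` a)%fset; last by apply: aeW => w sub.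
  apply: filterS (Xr _ _ sub) => w e sub'.
  by rewrite (bool_irrelevance sub' sub).
apply: filterS (ae_foralln H) => w Hw a' a sub.
by have := Hw (choice.pickle (a', a)); rewrite choice.pickleK; exact.
Qed.

(** On cylinders this is exchangeability of finite restrictions; cylinders are stable under
    intersection, so they determine the law of the whole family. *)
Lemma distrib_eq_act p (pb : bijective p) :
  distrib_eq P random_point (fun w => bds_act pb (random_point w) : prodT).
Proof.
have mY := measurable_random_point_X.
have mZ : measurable_fun setT (fun w => bds_act pb (random_point w) : prodT).
  apply: (@measurable_random_point _ _ D _ _
    (fun a w => bds_act pb (random_point w) a)) => a.
  exact: measurableT_comp (bds_measurable _) _.
move=> M mM.
apply: (@finite_measure_unique _ prodT R (@bds_cylinders R d D)
  (pushforward P random_point)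
  (pushforward P (fun w => bds_act pb (random_point w) : prodT))) => //.
- exact: bds_cylindersI.
- by apply: (fin_num_fun_lty (fin_num_measure P)).
move=> _ [a _ [A mA <-]]; rewrite /pushforward.
have mcyl : measurable (lim `&` (fun x : prodT => x a) @^-1` A : set prodT).
  by apply: measurable_fun_coord => //; exact: measurable_bds_lim.
have mXA : measurable (X a @^-1` A).
  by rewrite -[X in measurable X]setTI; exact: measurable_funPT.
have ki : injective (@restr_img p a) by exact: restr_img_inj (bij_inj pb).
pose c := [fset p i | i in a]%fset.
have mXc : measurable ((fun w => bds_map D ki (X c w)) @^-1` A).
  rewrite -[X in measurable X]setTI.
  exact: (measurableT_comp (bds_measurable ki) (measurable_funPT (X c))).
transitivity (P (X a @^-1` A)).
  apply: ae_eq_probability => //.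
    by rewrite -[X in measurable X]setTI; exact: mY.
  by apply: filterS random_point_lim => w Lw; split => [[]//|]; split.
transitivity (P ((fun w => bds_map D ki (X c w)) @^-1` A)).
  rewrite -(distrib_eq_map X_exch (@inj_id a) ki mA); congr (P _).
  by apply/seteqP; split => w /=; rewrite bds_map_id.
apply: ae_eq_probability => //.
  by rewrite -[X in measurable X]setTI; exact: mZ.
apply: filterS random_point_lim => w Lw; rewrite /preimage /=.
rewrite (@bds_actE _ _ _ _ _ _ a c _ ki Lw)//.
by split => [wA|[]//]; split => //; exact: bds_act_lim.
Qed.

Lemma measurable_event (M : set (bds_prod D)) : bds_lim_measurable M ->
  measurable [set w | M (fun a => X a w)].
Proof.
move=> /bds_lim_measurable_measurable mM.
by rewrite -[X in measurable X]setTI; exact: measurable_random_point_X.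
Qed.

(** The permutation of [n] carrying r to r' extends to a finitary bijection of all IDs, which
    preserves both the law of the family and the invariant event. *)
Lemma invariant_map (M : set (bds_prod D)) (n : nat) (b : finType)
    (r r' : b -> initseg n) (ri : injective r) (ri' : injective r')
    (A : set (D b)) : bds_invariant M -> measurable A ->
  P ([set w | M (fun a => X a w)] `&`
     [set w | A (bds_map D ri (X (initseg n) w))]) =
  P ([set w | M (fun a => X a w)] `&`
     [set w | A (bds_map D ri' (X (initseg n) w))]).
Proof.
move=> MI mA; have [mM _] := MI.
have mE (v : b -> initseg n) (vi : injective v) :
    measurable [set w | A (bds_map D vi (X (initseg n) w))].
  rewrite -[X in measurable X]setTI.
  exact: (measurableT_comp (bds_measurable vi) (measurable_funPT (X (initseg n)))).
have mEM := measurable_event mM.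
have [k kr] := inj_extend_perm ri ri'.
pose N : set prodT := [set x | M x] `&` (lim `&`
  (fun x : prodT => x (initseg n)) @^-1` (bds_map D ri @^-1` A)).
have mN : measurable N.
  apply: measurableI; first exact: bds_lim_measurable_measurable.
  apply: measurable_fun_coord; first exact: measurable_bds_lim.
  by rewrite -[X in measurable X]setTI; exact: bds_measurable.
have kb := perm_extend_bij k.
have := distrib_eq_act kb mN.
have mY : measurable (random_point @^-1` N).
  by rewrite -[X in measurable X]setTI; exact: measurable_random_point_X.
rewrite (_ : P (random_point @^-1` N) = P ([set w | M (fun a => X a w)] `&`
     [set w | A (bds_map D ri (X (initseg n) w))])); last first.
  apply: ae_eq_probability => //; first exact: measurableI.
  by apply: filterS random_point_lim => w Lw; split => [[? []]//|[]]; split.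
move=> ->; apply: ae_eq_probability.
- rewrite -[X in measurable X]setTI.
  apply: (@measurable_random_point _ _ D _ _
    (fun a w => bds_act kb (random_point w) a)) => //.
  by move=> a; exact: measurableT_comp (bds_measurable _) _.
- exact: measurableI.
apply: filterS random_point_lim => w Lw; rewrite /preimage /=.
have E : bds_map D ri (bds_act kb (random_point w) (initseg n)) =
    bds_map D ri' (X (initseg n) w).
  rewrite (@bds_actE _ _ _ _ _ _ _ (initseg n) _ (@perm_inj _ k) Lw); last first.
    by move=> i; rewrite perm_extend_val.
  by apply: bds_map_trans => i; rewrite /= kr.
have Mw := bds_invariant_act kb MI (perm_extend_finite k) Lw.
split=> [[/Mw Mx [_]]|[/Mw Mx]] /=; first by rewrite E.
by rewrite -E => Aw; split => //; split => //; exact: bds_act_lim.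
Qed.

(** By [invariant_map] the event correlates equally with A along every injection into [n], so the
    indicator of A may be replaced by its average. The L^2 distance of that average from its mean
    bounds the covariance. *)
Lemma invariant_independent (M : set (bds_prod D)) (a : {fset IDs})
    (A : set (D a)) : multiplicative_expectations X ->
  bds_invariant M -> measurable A ->
  (P ([set w | M (fun a => X a w)] `&` X a @^-1` A) =
  P [set w | M (fun a => X a w)] * P (X a @^-1` A))%E.
Proof.
move=> Xm MI mA; have [mM _] := MI.
set EM := [set w | _]; have mEM : measurable EM by exact: measurable_event.
have mXA : measurable (X a @^-1` A).
  by rewrite -[X in measurable X]setTI; exact: measurable_funPT.
have bA := bounded_measurable_indic R mA.
have bEM := bounded_measurable_indic R mEM.
have [N aN] := fset_sub_initseg a.
pose mu := Ex (fun w => \1_A (bds_map D (@inj_id a) (X a w)) : R).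
have muE : mu = fine (P (X a @^-1` A)).
  by rewrite -Rintegral_indicT//; apply: eq_Rintegral => w _; rewrite bds_map_id.
pose q := fine (P (EM `&` X a @^-1` A)).
suff sq : (q - fine (P EM) * mu) ^+ 2 <= 0.
  have /eqP : (q - fine (P EM) * mu) ^+ 2 = 0 by apply/eqP; rewrite eq_le sq sqr_ge0.
  rewrite sqrf_eq0 subr_eq0 => /eqP qE.
  rewrite -[LHS]fineK ?fin_num_measure//; last exact: measurableI.
  by rewrite -/q qE muE EFinM !fineK ?fin_num_measure.
(* The constant is that of [perm_avg_variance] with C = 1, for an indicator; n exceeds N to contain
   a, and #|a + a| for the variance bound. *)
apply: (@le0_of_le_inv_nat _ _ (2 * 1 ^+ 2 * #|{: a}|%:R ^+ 2)
  (maxn N #|{: a + a}|)) => n.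
rewrite gtn_max => /andP[Nn' an']; have Nn := ltnW Nn'.
have sub := fsubset_trans aN (initseg_sub Nn).
pose si := @fincl_inj _ _ _ sub.
have mE (v : a -> initseg n) (vi : injective v) :
    measurable [set w | A (bds_map D vi (X (initseg n) w))].
  rewrite -[X in measurable X]setTI.
  exact: (measurableT_comp (bds_measurable vi) (measurable_funPT (X (initseg n)))).
have E (v : a -> initseg n) (vi : injective v) :
    Ex (fun w => \1_EM w * \1_A (bds_map D vi (X (initseg n) w))) = q.
  rewrite /q -[X in X = _](_ : fine (P (EM `&`
      [set w | A (bds_map D vi (X (initseg n) w))])) = _); last first.
    by rewrite -Rintegral_indicT ?indicI//; exact: measurableI.
  rewrite (invariant_map vi si MI mA); congr fine; apply: ae_eq_probability => //.
  - exact: measurableI.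
  - exact: measurableI.
  have [Xr _] := X_exch; apply: filterS (Xr _ _ sub) => w e.
  by rewrite /setI /preimage /= -e.
pose Av w := perm_avg si (\1_A : _ -> R) (X (initseg n) w).
have bAv : bounded_measurable Av.
  by apply: bounded_measurable_comp => //; exact: bounded_measurable_perm_avg.
have bmu := bounded_measurable_cst T mu.
have EAv : Ex (fun w => \1_EM w * Av w) = q.
  transitivity (mean (fun p : {perm initseg n} =>
      Ex (fun w => \1_EM w *
        \1_A (bds_map D (inj_comp (@perm_inj _ p) si) (X (initseg n) w))))).
    rewrite -Rintegral_mean; last first.
      by move=> p; apply: bounded_measurableM => //; exact: (bounded_measurable_X X).
    apply: eq_Rintegral => w _; rewrite mulrC -meanZr.
    by apply: eq_mean => p; rewrite mulrC.
  have P0 : (0 < #|{perm initseg n}|)%N by apply/card_gt0P; exists 1%g.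
  by rewrite (eq_mean (G := fun=> q)) ?mean_const// => p; exact: E.
have bEA : bounded_measurable (fun w => \1_EM w * Av w) by exact: bounded_measurableM.
have bEmu : bounded_measurable (fun w => \1_EM w * mu) by exact: bounded_measurableM.
have bAmu : bounded_measurable (fun w => Av w - mu) by exact: bounded_measurableB.
have bf : bounded_measurable (fun w => \1_EM w * (Av w - mu)).
  exact: bounded_measurableM.
have -> : q - fine (P EM) * mu = Ex (fun w => \1_EM w * (Av w - mu)).
  under eq_Rintegral do rewrite mulrBr.
  have I h : bounded_measurable h -> P.-integrable setT (EFin \o h).
    exact: bounded_measurable_integrable.
  rewrite (RintegralB _ (I _ bEA) (I _ bEmu))// EAv.
  by rewrite (RintegralZr _ _ (I _ bEM))// Rintegral_indicT.
apply: le_trans (sqr_Rintegral_le P bf) _.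
have n0 : (0 < n)%N by rewrite (leq_ltn_trans _ an').
have A1 y : `|\1_A y : R| <= 1.
  by rewrite indicE; case: (y \in A); rewrite ?normr1// normr0.
have := @perm_avg_variance _ _ _ _ _ _ _ X_exch Xm _ _ 1 _ _ _ si _ (@inj_id a) bA A1.
rewrite card_initseg -/mu => /(_ (ltnW an') n0); apply: le_trans.
apply: le_RintegralT; [exact: bounded_measurableM|exact: bounded_measurableM|].
by move=> w; rewrite exprMn ler_piMl ?sqr_ge0// indicE.
Qed.

(** The finite measures sending Q to P(X in M and X in Q) and to P(X in M) P(X in Q) agree on
    cylinders, hence on all measurable sets; Q = M gives p = p^2. *)
Lemma multiplicative_ergodic : multiplicative_expectations X -> ergodic X.
Proof.
move=> Xm M MI; have [mM _] := MI.
set EM := [set w | _]; have mEM : measurable EM by exact: measurable_event.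
have mY := measurable_random_point_X.
have p0 : 0 <= fine (P EM) by rewrite fine_ge0.
pose m0 := mscale (NngNum p0) (pushforward P random_point).
pose m2 := m0 mY.
have PEM : (fine (P EM))%:E = P EM by rewrite fineK ?fin_num_measure.
have m2E A : m2 A = (P EM * P (random_point @^-1` A))%E by rewrite -PEM.
have m12 : forall A : set prodT, measurable A ->
    pushforward (mrestr P mEM) random_point A = m2 A.
  apply: (@finite_measure_unique _ prodT R (@bds_cylinders R d D)) => //.
  - exact: bds_cylindersI.
  - change (P (setT `&` EM) = (fine (P EM))%:E * P setT)%E.
    rewrite setTI PEM -[LHS]mule1; congr (_ * _)%E.
    exact: (esym (probability_setT P)).
  - change (P (setT `&` EM) < +oo)%E.
    by rewrite setTI ltey_eq fin_num_measure.
  move=> _ [a _ [A mA <-]].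
  set Z := lim `&` _; change (P (random_point @^-1` Z `&` EM) =
    (fine (P EM))%:E * P (random_point @^-1` Z))%E; rewrite PEM {}/Z.
  have mcyl : measurable (lim `&` (fun x : prodT => x a) @^-1` A : set prodT).
    by apply: measurable_fun_coord => //; exact: measurable_bds_lim.
  have mYc : measurable (random_point @^-1` (lim `&` (fun x : prodT => x a) @^-1` A)).
    by rewrite -[X in measurable X]setTI; exact: measurable_random_point_X.
  have mXA : measurable (X a @^-1` A).
    by rewrite -[X in measurable X]setTI; exact: measurable_funPT.
  have cylE : {ae P, forall w,
      (random_point @^-1` (lim `&` (fun x : prodT => x a) @^-1` A)) w <->
      (X a @^-1` A) w}.
    by apply: filterS random_point_lim => w Lw; split => [[]//|]; split.
  rewrite (ae_eq_probability mYc mXA cylE) setIC -(invariant_independent Xm MI mA).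
  apply: ae_eq_probability; [exact: measurableI|exact: measurableI|].
  by apply: filterS cylE => w cw; split => -[Mw]; split => //; apply/cw.
have := m12 M (bds_lim_measurable_measurable mM).
rewrite m2E /pushforward /mrestr (_ : random_point @^-1` M = EM)// setIid -PEM -EFinM.
move=> [] /eqP; rewrite -subr_eq0 -{1}[fine _]mulr1 -mulrBr mulf_eq0 subr_eq0.
by move=> /orP[/eqP ->|/eqP <-]; [left|right].
Qed.

End Ergodicity.

(** * Upper limits and bounded convergence *)

Section LimitSuperior.
Context (R : realType).

Lemma limn_esup_near_eq (u v : (\bar R)^nat) :
  (\forall n \near \oo, u n = v n) -> limn_esup u = limn_esup v.
Proof.
move=> [N _ uv]; rewrite !limn_esup_lim; apply: cvg_lim => //.
have H : esups v @ \oo --> limn (esups v) by exact: is_cvg_esups.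
apply: cvg_trans H; apply: near_eq_cvg; exists N => // n /= Nn.
congr ereal_sup; apply/seteqP.
by split => _ [k /= nk <-]; exists k => //; rewrite uv//=; apply: leq_trans nk.
Qed.

Lemma limn_esup_bounded (u : R^nat) (C : R) : (forall n, `|u n| <= C) ->
  ((- C)%:E <= limn_esup (fun n => (u n)%:E) <= C%:E)%E.
Proof.
move=> uC; rewrite limn_esup_lim; apply/andP; split.
  apply: lime_ge; first exact: is_cvg_esups.
  apply: nearW => n; apply: (@le_trans _ _ (u n)%:E).
    by rewrite lee_fin lerNl (le_trans (ler_norm _))// normrN.
  by apply: ereal_sup_ubound; exists n => /=.
apply: lime_le; first exact: is_cvg_esups.
apply: nearW => n; apply: ub_ereal_sup => _ [k _ <-].
by rewrite lee_fin (le_trans (ler_norm _)).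
Qed.

Lemma sum_half_pow (n : nat) : \sum_(0 <= j < n) (2 ^+ j)^-1 <= 2 :> R.
Proof.
suff : \sum_(0 <= j < n) (2 ^+ j)^-1 = 2 - 2 / 2 ^+ n :> R.
  by move=> ->; rewrite lerBlDr lerDl divr_ge0// exprn_ge0.
elim: n => [|n IH]; first by rewrite big_nil expr0 divr1 subrr.
rewrite big_nat_recr//= IH exprS invfM mulrA mulfV ?mul1r; last by rewrite pnatr_eq0.
by ring.
Qed.

End LimitSuperior.

(** * Almost sure convergence and limits of expectations *)

Section BoundedConvergence.
Context d (T : measurableType d) (R : realType) (P : probability T R).
Local Notation Ex f := (Rintegral P setT f).

Lemma cvg_Rintegral_bounded (Z : nat -> T -> R) (V : T -> R) (C : R) :
  (forall n, bounded_measurable (Z n)) -> bounded_measurable V ->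
  (forall n w, `|Z n w| <= C) ->
  {ae P, forall w, Z n w @[n --> \oo] --> V w} ->
  Ex (Z n) @[n --> \oo] --> Ex V.
Proof.
move=> bZ bV ZC ZV; apply: fine_cvg.
have [|||||_ _ H] := @dominated_convergence _ T R P setT measurableT
  (fun n w => (Z n w)%:E) (EFin \o V) (fun=> C%:E).
- by move=> n; apply/measurable_EFinP; case: (bZ n).
- by apply/measurable_EFinP; case: bV.
- apply: filterS ZV => w ZV _; apply/fine_cvgP; split; [exact: nearW|exact: ZV].
- exact: (bounded_measurable_integrable P (bounded_measurable_cst T C)).
- by apply: aeW => w n _; rewrite lee_fin.
rewrite /Rintegral fineK//.
by apply: integrable_fin_num => //; exact: bounded_measurable_integrable.
Qed.

(** The total variation of the sequence has expectation at most 2 K, so it is finite almost surely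
    and the telescoping series converges absolutely. *)
Lemma ae_cvg_summable (Z : nat -> T -> R) (K : R) :
  (forall n, bounded_measurable (Z n)) ->
  (forall n, Ex (fun w => `|Z n.+1 w - Z n w|) <= K / 2 ^+ n) ->
  {ae P, forall w, cvgn (Z^~ w)}.
Proof.
move=> bZ ZK.
pose f n w : \bar R := (`|Z n.+1 w - Z n w|)%:E.
have bf n : bounded_measurable (fun w => `|Z n.+1 w - Z n w|).
  by apply: bounded_measurable_norm; exact: bounded_measurableB.
have mf n : measurable_fun setT (f n) by apply/measurable_EFinP; case: (bf n).
have f0 n w : (0 <= f n w)%E by rewrite lee_fin.
have mS : measurable_fun setT (fun w => \sum_(0 <= n <oo) f n w)%E.
  have := ge0_emeasurable_sum (P := xpredT) (fun k x _ _ => f0 k x) (fun k _ => mf k).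
  exact.
have K0 : 0 <= K.
  by rewrite -[K]divr1; apply: le_trans (ZK 0%N); exact: Rintegral_ge0.
have iS : P.-integrable setT (fun w => \sum_(0 <= n <oo) f n w)%E.
  apply/integrableP; split => //.
  under eq_integral => w _ do rewrite gee0_abs ?nneseries_ge0//.
  rewrite integral_nneseries//.
  apply: (@le_lt_trans _ _ (2 * K)%:E); last exact: ltry.
  apply: lime_le.
    by apply: is_cvg_nneseries => n _ _; exact: integral_ge0.
  apply: nearW => n.
  rewrite (eq_bigr (fun k => (Ex (fun w => `|Z k.+1 w - Z k w|))%:E)).
    rewrite sumEFin lee_fin (le_trans (ler_sum _ (fun k _ => ZK k)))//.
    by rewrite -mulr_sumr mulrC ler_wpM2r// sum_half_pow.
  move=> k _; rewrite /Rintegral fineK//.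
  by apply: integrable_fin_num => //; exact: (bounded_measurable_integrable P (bf k)).
apply: filterS (integrable_ae measurableT iS) => w /(_ I) Sfin.
have nc : cvgn [normed series (telescope (Z^~ w))].
  apply: nondecreasing_is_cvgn.
    by apply: nondecreasing_series => n _ _; exact: normr_ge0.
  exists (fine (\sum_(0 <= n <oo) f n w)%E) => _ [n _ <-].
  rewrite -lee_fin fineK// /series /= -sumEFin.
  by apply: (nneseries_lim_ge (P := xpredT)) => k _ _; exact: f0.
have := normed_cvg nc; rewrite telescopeK => c.
have : cvgn (fun n => (Z n w - Z 0%N w) + Z 0%N w).
  by apply: is_cvgD => //; exact: is_cvg_cst.
by under eq_fun do rewrite subrK.
Qed.

(* If F <= 0 has probability 0 or 1, then |F| is almost surely F or - F. *)
Lemma Rintegral_norm_eq0 (F : T -> R) : bounded_measurable F -> Ex F = 0 ->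
  P [set w | F w <= 0] = 0%E \/ P [set w | F w <= 0] = 1%E ->
  Ex (fun w => `|F w|) = 0.
Proof.
move=> bF EF.
have mQ : measurable [set w | F w <= 0].
  have [mF _] := bF.
  have := mF measurableT _ (measurable_itv `]-oo, 0]); rewrite setTI.
  by congr measurable; apply/seteqP; split => w /=; rewrite in_itv.
have bnF := bounded_measurable_norm bF.
have bmF : bounded_measurable (fun w => - 1 * F w).
  by apply: bounded_measurableM => //; exact: bounded_measurable_cst.
case=> [Q0|Q1].
  rewrite -EF; apply: ae_eq_Rintegral => //.
  exists [set w | F w <= 0]; split => // w /=.
  by apply: contra_notP => /negP; rewrite -ltNge => /ltW F0; rewrite ger0_norm.
transitivity (Ex (fun w => - 1 * F w)).
  apply: ae_eq_Rintegral => //.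
  exists (~` [set w | F w <= 0]); split; first exact: measurableC.
    by rewrite probability_setC// Q1 subee.
  move=> w /=; apply: contra_not => F0.
  by rewrite ler0_norm ?mulN1r.
rewrite RintegralZl ?EF ?mulr0//.
exact: (bounded_measurable_integrable P bF).
Qed.

End BoundedConvergence.

(** * Ergodic measurements *)

Section ErgodicMultiplicative.
Context (R : realType) (d : measure_display) (D : BDS R d).
Context d' (T : measurableType d') (P : probability T R).
Context (X : forall a : {fset IDs}, {RV P >-> D a}).
Hypothesis X_exch : exchangeable_measurement X.
Local Notation Ex f := (Rintegral P setT f).
Local Notation lim := (@bds_lim R d D).
Local Notation prodT := (g_sigma_algebraType (@bds_cylinders R d D)).

(** Once [n] contains the support of p, the bijection maps [n] into itself, and averages over [n]
    ignore it. *)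
Lemma perm_avg_act (b : finType) (g : D b -> R) (p : IDs -> IDs)
    (pb : bijective p) : finite_set [set i | p i <> i] ->
  exists N, forall n (s : b -> initseg n) (si : injective s) (x : bds_prod D),
    (N <= n)%N -> lim x ->
    perm_avg si g (bds_act pb x (initseg n)) = perm_avg si g (x (initseg n)).
Proof.
move=> /finite_fsetP[F FE].
have [N FN] := fset_sub_initseg F.
exists N => n s si x Nn Lx.
have H (i : initseg n) : p (val i) \in initseg n.
  have [->|/eqP pi] := eqVneq (p (val i)) (val i); first exact: valP.
  have : [set` F] (p (val i)) by rewrite -FE /= => /(bij_inj pb).
  by move=> /= /(fsubsetP FN); exact: (fsubsetP (initseg_sub Nn)).
pose k i := [` H i]%fset.
have ki : injective k by move=> i j /(congr1 val) /= /(bij_inj pb)/val_inj.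
by rewrite (@bds_actE _ _ _ _ pb x _ (initseg n) k ki Lx)// perm_avg_map.
Qed.

Section LimitOfAverages.
Context (b : finType) (g : D b -> R) (C : R) (n : nat -> nat)
  (s : forall j, b -> initseg (n j)) (si : forall j, injective (s j)).
Hypotheses (bg : bounded_measurable g) (gC : forall y, `|g y| <= C).
Hypothesis n_homo : {homo n : i j / (i <= j)%N}.
Hypothesis n_ge : forall j, (4 ^ j <= n j)%N.
Hypothesis n_card : forall j, (#|{: b + b}| <= n j)%N.

Let A j (x : bds_prod D) : R := perm_avg (@si j) g (x (initseg (n j))).

(** An upper limit exists at every point, so U is invariant everywhere on the limit and not just
    almost surely, as [bds_invariant] demands. The averages are bounded by C, so [fine] loses
    nothing. *)
Let U (x : bds_prod D) : R := fine (limn_esup (fun j => (A j x)%:E)).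

Let AC j x : `|A j x| <= C.
Proof. exact: perm_avg_bounded. Qed.

Let EU x : (U x)%:E = limn_esup (fun j => (A j x)%:E).
Proof.
have /andP[l u] := limn_esup_bounded (fun j => AC j x).
by rewrite fineK// fin_numElt (lt_le_trans _ l) ?ltNyr// (le_lt_trans u) ?ltry.
Qed.

Let UC x : `|U x| <= C.
Proof.
by rewrite ler_norml -!lee_fin EU; exact: (limn_esup_bounded (fun j => AC j x)).
Qed.

Let measurable_A j : measurable_fun (lim : set prodT) (A j : prodT -> R).
Proof.
have [mA _] := bounded_measurable_perm_avg (@si j) bg.
exact: (measurableT_comp mA (@measurable_fun_coord _ _ D (initseg (n j)))).
Qed.

Let measurable_U : measurable_fun (lim : set prodT) (U : prodT -> R).
Proof.
apply/measurable_EFinP.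
rewrite (_ : EFin \o U = fun x => limn_esup (fun j => (A j x)%:E)); last first.
  by apply/funext => x /=; exact: EU.
by apply: measurable_fun_limn_esup => j; exact/measurable_EFinP.
Qed.

Let U_act p (pb : bijective p) x : finite_set [set i | p i <> i] -> lim x ->
  U (bds_act pb x) = U x.
Proof.
move=> /(perm_avg_act g pb)[N HN] Lx; congr fine; apply: limn_esup_near_eq.
exists N => // j /= Nj; rewrite /A HN//.
by apply: leq_trans (n_ge j); apply: leq_trans Nj _; apply: ltnW; exact: ltn_expl.
Qed.

Let level_invariant (c : R) : bds_invariant (lim `&` [set x | U x <= c]).
Proof.
apply: bds_invariantI.
  rewrite -[X in X `&` _]setIid -setIA; apply: measurable_bds_lim_measurable.
  have := measurable_U (@measurable_bds_lim _ _ D) (measurable_itv `]-oo, c]).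
  by congr measurable; apply/seteqP; split => x [Lx] /=; rewrite in_itv.
move=> p pb x pfin [Lx /= Ux]; split; first exact: bds_act_lim.
by rewrite /= U_act.
Qed.

Let Z j w : R := A j (random_point X w).
Let V w : R := U (random_point X w).
Let mu := Ex (fun w => Z 0 w).

Let bZ j : bounded_measurable (Z j).
Proof.
split; last by exists C => w; exact: AC.
have [mA _] := bounded_measurable_perm_avg (@si j) bg.
exact: measurableT_comp mA _.
Qed.

Let bV : bounded_measurable V.
Proof.
split; last by exists C => w; exact: UC.
apply/measurable_EFinP.
rewrite (_ : EFin \o V = fun w => limn_esup (fun j => (Z j w)%:E)); last first.
  by apply/funext => x /=; exact: EU.
apply: measurable_fun_limn_esup => j; apply/measurable_EFinP.
by case: (bZ j).
Qed.

Let C0 : 0 <= C.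
Proof. by apply: le_trans (AC 0 (fun=> point)). Qed.

Let ZV : {ae P, forall w, Z j w @[j --> \oo] --> V w}.
Proof.
have cvgZ : {ae P, forall w, cvgn (Z^~ w)}.
  pose K := 4 * C ^+ 2 * #|b|%:R ^+ 2.
  have K0 : 0 <= K by exact: mulr_ge0 (mulr_ge0 (ler0n _ 4) (sqr_ge0 _)) (sqr_ge0 _).
  (* The squared L^2 increment is at most K / 4^j; since K <= (K + 1)^2, the constant K + 1 spares a
     square root. *)
  apply: (@ae_cvg_summable _ _ _ _ _ (K + 1)) => // j.
  have bd : bounded_measurable (fun w => `|Z j.+1 w - Z j w|).
    by apply: bounded_measurable_norm; exact: bounded_measurableB.
  have K1 : 0 <= (K + 1) / 2 ^+ j by rewrite divr_ge0 ?addr_ge0// exprn_ge0.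
  rewrite -ler_sqr ?nnegrE//; last by apply: Rintegral_ge0.
  apply: le_trans (sqr_Rintegral_le P bd) _.
  rewrite (_ : Ex _ = Ex (fun w => (Z j w - Z j.+1 w) ^+ 2)); last first.
    by apply: eq_Rintegral => w _; rewrite distrC real_normK ?num_real.
  have n0 : (0 < n j)%N by apply: leq_trans (n_ge j); rewrite expn_gt0.
  have := Rintegral_perm_avg_cauchy X_exch bg gC (@si j) (@si j.+1)
    (initseg_sub (n_homo (leqnSn j))).
  rewrite card_initseg => /(_ (n_card j) n0) /le_trans; apply.
  rewrite -/K expr_div_n -exprM mulnC exprM.
  rewrite (_ : 2 ^+ 2 = 4%:R :> R); last by rewrite -natrX.
  apply: (@le_trans _ _ (K / 4%:R ^+ j)).
    rewrite ler_wpM2l// lef_pV2 ?posrE ?exprn_gt0 ?ltr0n//.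
    by rewrite -natrX ler_nat.
  rewrite ler_wpM2r ?invr_ge0 ?exprn_ge0//.
  rewrite (_ : (K + 1) ^+ 2 = K + (K ^+ 2 + K + 1)); last by ring.
  by rewrite lerDl !addr_ge0 ?sqr_ge0.
apply: filterS cvgZ => w cZ.
have cE : (Z j w)%:E @[j --> \oo] --> (limn (Z^~ w))%:E.
  by apply/fine_cvgP; split; [exact: nearW|exact: cZ].
suff -> : V w = limn (Z^~ w) by exact: cZ.
apply: EFin_inj; rewrite EU is_cvg_limn_esupE; first exact: cvg_lim cE.
by apply/cvg_ex; eexists; exact: cE.
Qed.

Let EZ j : Ex (Z j) = mu.
Proof.
rewrite [LHS](Rintegral_perm_avg X_exch bg (@si j) (@si 0)).
by rewrite /mu (Rintegral_perm_avg X_exch bg (@si 0) (@si 0)).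
Qed.

(** H is an arbitrary bounded variable, possibly dependent on the averages: their limit V has L^1
    distance 0 from the constant mu. *)
Lemma ergodic_cvg_averages (H : T -> R) : ergodic X -> bounded_measurable H ->
  Ex (fun w => perm_avg (@si j) g (X (initseg (n j)) w) * H w) @[j --> \oo] -->
  mu * Ex H.
Proof.
move=> Xerg bH; have [_ [C' HC']] := bH.
have EV : Ex V = mu.
  have := cvg_Rintegral_bounded bZ bV (fun j w => AC j _) ZV.
  under eq_fun do rewrite EZ.
  by move=> /(cvg_lim (@Rhausdorff R)) <-; apply: lim_cst.
pose F w := V w - mu.
have bF : bounded_measurable F.
  by apply: bounded_measurableB => //; exact: bounded_measurable_cst.
have EF : Ex F = 0.
  have I h : bounded_measurable h -> P.-integrable setT (EFin \o h).
    exact: bounded_measurable_integrable.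
  rewrite (RintegralB _ (I _ bV) (I _ (bounded_measurable_cst T mu)))//.
  by rewrite Rintegral_cstT EV subrr.
have MI := level_invariant mu.
(* The event seen by ergodicity also requires compatibility, which holds almost surely. *)
have PF : P [set w | (lim `&` [set x | U x <= mu]) (fun a => X a w)] =
    P [set w | F w <= 0].
  apply: ae_eq_probability.
  - by apply: measurable_event; case: MI.
  - have [mF _] := bF.
    have := mF measurableT _ (measurable_itv `]-oo, 0]); rewrite setTI.
    by congr measurable; apply/seteqP; split => w /=; rewrite in_itv.
  apply: filterS (random_point_lim X_exch) => w Lw; rewrite /= /F subr_le0.
  by split => [[]|]; last by split.
have F0 : Ex (fun w => `|F w|) = 0.
  by apply: Rintegral_norm_eq0 => //; rewrite -PF; exact: Xerg.
have bVH : bounded_measurable (fun w => V w * H w) by exact: bounded_measurableM.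
have -> : mu * Ex H = Ex (fun w => V w * H w).
  have bmH : bounded_measurable (fun w => mu * H w).
    by apply: bounded_measurableM => //; exact: bounded_measurable_cst.
  have I h : bounded_measurable h -> P.-integrable setT (EFin \o h).
    exact: bounded_measurable_integrable.
  rewrite -(RintegralZl _ _ (I _ bH))//; apply/esym/eqP; rewrite -subr_eq0.
  rewrite -(RintegralB _ (I _ bVH) (I _ bmH))// -normr_le0.
  have bFH : bounded_measurable (fun w => V w * H w - mu * H w).
    exact: bounded_measurableB.
  rewrite (le_trans (le_normr_Rintegral _ (I _ bFH)))//.
  have <- : Ex (fun w => C' * `|F w|) = 0.
    by rewrite (RintegralZl _ _ (I _ (bounded_measurable_norm bF)))// F0 mulr0.
  apply: le_RintegralT.
  - exact: bounded_measurable_norm.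
  - apply: bounded_measurableM; first exact: bounded_measurable_cst.
    exact: bounded_measurable_norm.
  by move=> w; rewrite -mulrBl normrM mulrC ler_wpM2r.
have ZHC j w : `|Z j w * H w| <= C * C'.
  by rewrite normrM; apply: ler_pM => //; exact: AC.
have bZH j : bounded_measurable (fun w => Z j w * H w) by exact: bounded_measurableM.
apply: (cvg_Rintegral_bounded bZH bVH ZHC).
by apply: filterS ZV => w Zw; apply: cvgM => //; exact: cvg_cst.
Qed.

End LimitOfAverages.

Lemma ergodic_multiplicative : ergodic X -> multiplicative_expectations X.
Proof.
move=> Xerg b c g h a r ri s si t ti bg bh.
have [[_ [C gC]] [_ [C' hC]]] := (bg, bh).
(* The offset makes room for b + c, on which the tensor lives, and for b + b, which the second
   moment bounds require. *)
pose m0 := (#|{: b + c}| + #|{: b + b}|)%N.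
pose n j := (m0 + 4 ^ j)%N.
have nh : {homo n : i j / (i <= j)%N}.
  by move=> i j ij; rewrite /n leq_add2l leq_exp2l.
have nge j : (4 ^ j <= n j)%N by exact: leq_addl.
have nbb j : (#|{: b + b}| <= n j)%N.
  by rewrite /n /m0 -addnA addnCA leq_addr.
have nbc j : (#|{: b + c}| <= n j)%N by rewrite /n /m0 -addnA leq_addr.
have sx j : {v : b + c -> initseg (n j) | injective v}.
  by apply: cid; apply: inj_exists; rewrite card_initseg.
pose v j := projT1 (sx j); have vi j : injective (v j) := projT2 (sx j).
have vli j : injective (v j \o inl) by exact: inj_comp (vi j) (@inl_inj _ _).
have vri j : injective (v j \o inr) by exact: inj_comp (vi j) (@inr_inj _ _).
(* H stays on [n 0] while the averages move on; in [lim2] it is read inside [n j] through the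
   inclusion. *)
pose H w := h (bds_map D (vri 0) (X (initseg (n 0)) w)).
have bH : bounded_measurable H by exact: (bounded_measurable_X X).
have bt := bounded_measurable_tensor bg bh.
(* One sequence with two limits: ergodicity yields the product of expectations, the collision
   estimate yields the tensor. *)
have lim1 := ergodic_cvg_averages (si := vli) bg gC nh nge nbb Xerg bH.
have lim2 :
    Ex (fun w => perm_avg (vli j) g (X (initseg (n j)) w) * H w) @[j --> \oo] -->
    Ex (fun w => tensor g h (bds_map D ri (X a w))).
  pose K := (2 * C * C') * #|b|%:R * #|c|%:R.
  have n0 : (n j)%:R^-1 @[j --> \oo] --> (0 : R).
    apply/gtr0_cvgV0.
      by apply: nearW => j; rewrite ltr0n (leq_trans _ (nge j))// expn_gt0.
    apply/cvgrnyP/cvgnyPge => A; exists A => // j /= Aj.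
    by apply: leq_trans (nge j); apply: leq_trans Aj _; apply: ltnW; exact: ltn_expl.
  have Kn0 : K * (n j)%:R^-1 @[j --> \oo] --> (0 : R).
    by rewrite -[X in _ --> X](mulr0 K); apply: cvgMr.
  apply/subr_cvg0; apply: norm_cvg0; apply: (squeeze_cvgr _ (cvg_cst 0) Kn0).
  apply: nearW => j; rewrite normr_ge0 /=.
  have ui : injective (fincl (initseg_sub (nh _ _ (leq0n j))) \o (v 0 \o inr)).
    exact: inj_comp (@fincl_inj _ _ _ _) (vri 0).
  have -> : Ex (fun w => perm_avg (vli j) g (X (initseg (n j)) w) * H w) =
      Ex (fun w => perm_avg (vli j) g (X (initseg (n j)) w) *
                   h (bds_map D ui (X (initseg (n j)) w))).
    have bA : bounded_measurable (fun w => perm_avg (vli j) g (X (initseg (n j)) w)).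
      by apply: bounded_measurable_comp => //; exact: bounded_measurable_perm_avg.
    apply: ae_eq_Rintegral.
    - exact: bounded_measurableM.
    - by apply: bounded_measurableM => //; exact: (bounded_measurable_X X).
    have := X_fincl_ae X_exch (vri 0) ui (fun=> erefl).
    by apply: filterS => w e; rewrite /H e.
  rewrite (Rintegral_map X_exch ri (vi j) bt) -/K.
  have := Rintegral_perm_avg_approx X_exch bg (vli j) ui (vi j) _ bh gC hC.
  by rewrite card_initseg; apply; rewrite (leq_trans _ (nge j))// expn_gt0.
rewrite -(cvg_lim (@Rhausdorff R) lim2) (cvg_lim (@Rhausdorff R) lim1).
by congr (_ * _); [exact: (Rintegral_perm_avg X_exch bg)|exact: (Rintegral_map X_exch)].
Qed.

End ErgodicMultiplicative.

Theorem theorem8 (R : realType) (d : measure_display) (D : BDS R d)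
    (d' : measure_display) (Omega : measurableType d')
    (P : probability Omega R) (X : forall a : {fset IDs}, {RV P >-> D a})
    (X_exch : exchangeable_measurement X) :
  (ergodic X <-> independence_property X) /\
  (ergodic X <-> deterministic_approximation X).
Proof.
have erg_mult : ergodic X <-> multiplicative_expectations X.
  split; first exact: ergodic_multiplicative.
  exact: multiplicative_ergodic.
split; rewrite erg_mult; split.
- exact: multiplicative_independence.
- exact: independence_multiplicative.
- exact: multiplicative_approximation.
- exact: approximation_multiplicative.
Qed.
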